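(* Let $F:\mathbb{R}^d\to\mathbb{R}$ be $L$-smooth and bounded from below by $F^*\in\mathbb{R}$, and let $\nabla f(x,\xi)$ be a stochastic gradient oracle satisfying, for some $p\in(1,2]$ and $\sigma\in(0,\infty)$, $\mathbb{E}[\nabla f(x,\xi)]=\nabla F(x)$ and $\mathbb{E}[|\nabla f(x,\xi)|^p]\le\sigma^p$ for all $x\in\mathbb{R}^d$. Let $T,n\in\mathbb{N}_{\ge1}$, let $x_1\in\mathbb{R}^d$, $\Delta_1:=F(x_1)-F^*$, and let $\delta\in(0,1)$. Then for any step sizes $\eta_1,\dots,\eta_T$ with $0<\eta_t<1/L$, the iterates $x_1,\dots,x_T$ generated by PS-Clip-SGD with batch size $n$ and parameters $$\alpha=\frac{\sigma}{(\log(1/\delta)+1/4)^{1/p}},\qquad \beta=p$$ satisfy, with probability at least $1-\delta$, $$\sum_{t=1}^T\frac{\eta_t|\nabla F(x_t)|^2}{\sum_{t=1}^T\eta_t}\le\frac{2\Delta_1}{\sum_{t=1}^T\eta_t}+49\sigma^2\left(\frac{\log(1/\delta)+\log(T)+1/4}{n}\right)^{\frac{2(p-1)}{p}}.$$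
   Context: $|\cdot|$ is the Euclidean norm on $\mathbb{R}^d$, $d\ge1$. $F$ is $L$-smooth ($L>0$) if it is differentiable and $|\nabla F(x)-\nabla F(y)|\le L|x-y|$ for all $x,y\in\mathbb{R}^d$. The stochastic gradient oracle is a (measurable) map $(x,\xi)\mapsto\nabla f(x,\xi)\in\mathbb{R}^d$, where $\xi$ is a random variable with distribution $\mathcal{D}$; expectations in the oracle assumptions are over $\xi\sim\mathcal{D}$. PS-Clip-SGD (per-sample clipped SGD) with parameters $\alpha,\beta>0$, batch size $n$ and step sizes $\eta_t>0$, started at the point $x_1$: at each iteration $t=1,\dots,T$ draw i.i.d. samples $\xi_t^{(1)},\dots,\xi_t^{(n)}\sim\mathcal{D}$, independent of the samples of all previous iterations (hence independent of $x_t$), and set $$G(x_t,\alpha,\beta)=\frac1n\sum_{k=1}^n\gamma_t^{(k)}\nabla f(x_t,\xi_t^{(k)}),\qquad \gamma_t^{(k)}=\min\Big\{1,\frac{\alpha k^{1/\beta}}{|\nabla f(x_t,\xi_t^{(k)})|}\Big\}$$ (with $\gamma_t^{(k)}=1$ if $\nabla f(x_t,\xi_t^{(k)})=0$), and $x_{t+1}=x_t-\eta_t G(x_t,\alpha,\beta)$. *)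

(* Defs.v *)
From mathcomp Require Import all_boot all_order all_algebra.
From mathcomp Require Import all_classical all_reals all_analysis.

Set Implicit Arguments.
Unset Strict Implicit.
Unset Printing Implicit Defensive.

Import Order.TTheory GRing.Theory Num.Theory.
Import numFieldNormedType.Exports.

Local Open Scope classical_set_scope.
Local Open Scope ring_scope.

(* The library's norm on ['rV[R]_d] is the sup norm. The Euclidean norm is
   needed here; both induce the same topology and the same differentiability. *)
Definition enorm (R : realType) (d : nat) (v : 'rV[R]_d) : R :=
  Num.sqrt (\sum_(i < d) v 0 i ^+ 2).

Definition gradient (R : realType) (d : nat) (F : 'rV[R]_d -> R)
    (x : 'rV[R]_d) : 'rV[R]_d :=
  \row_(i < d) 'D_(delta_mx 0 i) F x.

Definition smooth (R : realType) (d : nat) (L : R) (F : 'rV[R]_d -> R) : Prop :=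
  (forall x, differentiable F x) /\
  (forall x y, enorm (gradient F x - gradient F y) <= L * enorm (x - y)).

Definition borel_rV (R : realType) (d : nat) :=
  g_sigma_algebraType (open : set (set 'rV[R]_d)).

(* The expectation of a random vector is taken coordinatewise. Integrability of
   the coordinates follows from the moment bound, because [1 < p]. *)
Definition stochastic_gradient_oracle (R : realType) (d : nat)
    (dX : measure_display) (X : measurableType dX) (D : probability X R)
    (p sigma : R) (F : 'rV[R]_d -> R) (g : 'rV[R]_d -> X -> 'rV[R]_d) : Prop :=
  [/\ measurable_fun setT
        (fun z : borel_rV R d * X => g z.1 z.2 : borel_rV R d),
      forall x (i : 'I_d),
        ('E_D[(fun xi => g x xi 0 i)%R] = (gradient F x 0 i)%:E)%E
    & forall x, ('E_D[(fun xi => enorm (g x xi) `^ p)%R] <= (sigma `^ p)%:E)%E].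

Definition mutually_independent (R : realType) (dO dX : measure_display)
    (Omega : measurableType dO) (X : measurableType dX) (P : probability Omega R)
    (I : finType) (Y : I -> {RV P >-> X}) : Prop :=
  forall (J : {set I}) (A : I -> set X),
    (forall i, i \in J -> measurable (A i)) ->
    P (\bigcap_(i in [set` J]) (Y i @^-1` A i)) =
    (\prod_(i in J) P (Y i @^-1` A i))%E.

(* [xi t k] is the [k]-th sample of iteration [t], for [1 <= t <= T] and
   [1 <= k <= n]; values at other indices are irrelevant. *)
Definition iid_samples (R : realType) (dO dX : measure_display)
    (Omega : measurableType dO) (X : measurableType dX) (P : probability Omega R)
    (D : probability X R) (T n : nat) (xi : nat -> nat -> {RV P >-> X}) : Prop :=
  (forall t k, (1 <= t <= T)%N -> (1 <= k <= n)%N ->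
     forall A, measurable A -> distribution P (xi t k) A = D A) /\
  mutually_independent (fun i : 'I_T * 'I_n => xi i.1.+1 i.2.+1).

Definition clip_factor (R : realType) (d : nat) (alpha beta : R) (k : nat)
    (v : 'rV[R]_d) : R :=
  if v == 0 then 1 else Num.min 1 (alpha * k%:R `^ (1 / beta) / enorm v).

Definition ps_clip_gradient (R : realType) (d : nat) (X : Type)
    (g : 'rV[R]_d -> X -> 'rV[R]_d) (alpha beta : R) (n : nat)
    (x : 'rV[R]_d) (xi : nat -> X) : 'rV[R]_d :=
  (1 / n%:R) *: \sum_(1 <= k < n.+1)
    clip_factor alpha beta k (g x (xi k)) *: g x (xi k).

(* Iterates and step sizes are indexed from 1; [x 0] is irrelevant. *)
Definition ps_clip_sgd (R : realType) (d : nat) (Omega X : Type)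
    (g : 'rV[R]_d -> X -> 'rV[R]_d) (alpha beta : R) (T n : nat)
    (eta : nat -> R) (x1 : 'rV[R]_d) (xi : nat -> nat -> Omega -> X)
    (x : nat -> Omega -> 'rV[R]_d) : Prop :=
  (forall w, x 1%N w = x1) /\
  (forall t w, (1 <= t <= T)%N ->
     x t.+1 w = x t w -
       eta t *: ps_clip_gradient g alpha beta n (x t w) (fun k => xi t k w)).

(* Main.v *)
(** By L-smoothness and eta_t < 1/L, the weighted mean of |grad F(x_t)|^2 is at
    most 2 Delta_1 / sum eta plus the weighted mean of |G_t - grad F(x_t)|^2, so
    only the latter has to be bounded.  Put c = ln(1/delta) + 1/4 and let
    b = sigma (n/c)^(1/p) be the largest clipping level; if c >= n, then b is at
    most sigma and the bound is trivial.

    Otherwise, cosh|v| is a convex function of |v|^2, which gives, for vectors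
    s, z, the Pinelis-type inequality
      cosh|s+z| <= cosh|s| (e^|z| - |z|) + (sinh|s|/|s|) <s,z>.
    Applying it to the increments z of (1/b) sum_k (clip_k - grad F(x_t)) and
    integrating one sample at a time, conditionally on all previous samples,
    yields E cosh(n |G_t - grad F(x_t)| / b) <= e^(4c): a term 3c from the
    second moments of the clipped gradients and c from the clipping bias.

    The same convexity in |v|^2 and Jensen's inequality carry this bound over
    to the square root of the weighted mean of the squared errors, and Markov's
    inequality at level 7c gives failure probability at most
    2 e^(-3c) <= delta.  There is no union bound over the iterations. *)

From HB Require Import structures.
Require Import Defs.
From mathcomp Require Import all_boot all_order all_algebra.
From mathcomp Require Import all_classical all_reals all_analysis.
From mathcomp Require Import measurable_realfun.
From mathcomp Require Import ring lra.

Set Implicit Arguments.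
Unset Strict Implicit.
Unset Printing Implicit Defensive.

Import Order.TTheory GRing.Theory Num.Theory.
Import numFieldNormedType.Exports.

Local Open Scope classical_set_scope.
Local Open Scope ring_scope.

(** * The hyperbolic cosine *)

Definition cosh (R : realType) (v : R) : R := (expR v + expR (- v)) / 2.
Definition sinh (R : realType) (v : R) : R := (expR v - expR (- v)) / 2.

(** Mean value theorem, with the sign of the derivative asked only on [[a, b]]; the calculus
    inequalities for [cosh], [sinh] and [expR] and the descent inequality reduce to it. *)
Lemma ger0_is_derive_le (R : realType) (f df : R -> R) (a b : R) : a <= b ->
  (forall x : R, is_derive x (1 : R) f (df x)) ->
  (forall x, a <= x <= b -> 0 <= df x) ->
  f a <= f b.
Proof.
move=> ab fdf df0; rewrite -subr_ge0.
have [|c] := MVT_segment ab (fun x _ => fdf x).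
  by apply: derivable_within_continuous => x _; exact: ex_derive.
rewrite in_itv/= => cab ->.
by rewrite mulr_ge0 ?subr_ge0// df0.
Qed.

#[local] Instance is_derive_cosh (R : realType) (x : R) :
  is_derive x (1 : R) (@cosh R) (sinh x).
Proof.
rewrite /cosh; apply: is_derive_eq.
by rewrite /sinh/GRing.scale/=; ring.
Qed.

#[local] Instance is_derive_sinh (R : realType) (x : R) :
  is_derive x (1 : R) (@sinh R) (cosh x).
Proof.
rewrite /sinh; apply: is_derive_eq.
by rewrite /cosh/GRing.scale/=; ring.
Qed.

Section hyperbolic.
Context (R : realType).
Implicit Types u v a b : R.

Lemma cosh_ge1 v : 1 <= cosh v.
Proof.
rewrite /cosh expRN ler_pdivlMr// mul1r.
have := expR_gt0 v; set e := expR v => e0.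
rewrite -subr_ge0 (_ : _ - _ = (e - 1) ^+ 2 / e).
  by rewrite divr_ge0 ?sqr_ge0// ltW.
by field; rewrite gt_eqF.
Qed.

Lemma cosh_gt0 v : 0 < cosh v.
Proof. exact: lt_le_trans ltr01 (cosh_ge1 _). Qed.

Lemma coshN v : cosh (- v) = cosh v.
Proof. by rewrite /cosh opprK addrC. Qed.

Lemma cosh_norm v : cosh `|v| = cosh v.
Proof. by case: (ger0P v) => // _; exact: coshN. Qed.

Lemma coshD u v : cosh (u + v) = cosh u * cosh v + sinh u * sinh v.
Proof. by rewrite /cosh /sinh opprD !expRD; field. Qed.

Lemma coshB u v : cosh (u - v) = cosh u * cosh v - sinh u * sinh v.
Proof. by rewrite /cosh /sinh opprB !expRD; field. Qed.

Lemma cosh0 : cosh 0 = 1 :> R.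
Proof. by rewrite /cosh oppr0 expR0; field. Qed.

Lemma sinh0 : sinh 0 = 0 :> R.
Proof. by rewrite /sinh oppr0 subrr mul0r. Qed.

Lemma addr_cosh_sinh v : cosh v + sinh v = expR v.
Proof. by rewrite /cosh /sinh; field. Qed.

Lemma cosh_ge_expR v : expR v / 2 <= cosh v.
Proof. by rewrite /cosh ler_pM2r ?invr_gt0// lerDl expR_ge0. Qed.

Lemma sinh_le_cosh v : sinh v <= cosh v.
Proof.
rewrite /sinh /cosh ler_pM2r ?invr_gt0// lerD2l.
by apply: le_trans (expR_ge0 _); rewrite oppr_le0 expR_ge0.
Qed.

Lemma sinh_ge v : 0 <= v -> v <= sinh v.
Proof.
move=> v0; rewrite -subr_ge0.
have -> : 0 = sinh 0 - 0 :> R by rewrite sinh0 subr0.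
apply: (ger0_is_derive_le (df := fun x => cosh x - 1)) => // x _.
by rewrite subr_ge0 cosh_ge1.
Qed.

Lemma sinh_ge0 v : 0 <= v -> 0 <= sinh v.
Proof. by move=> v0; exact: le_trans (sinh_ge v0). Qed.

Lemma sinh_le_mul_cosh v : 0 <= v -> sinh v <= v * cosh v.
Proof.
move=> v0; rewrite -subr_ge0.
have -> : 0 = 0 * cosh 0 - sinh 0 :> R by rewrite sinh0 mul0r subr0.
apply: (ger0_is_derive_le (f := fun x => x * cosh x - sinh x)
  (df := fun x => x * sinh x)) => //.
  move=> x; apply: is_derive_eq.
  by rewrite /GRing.scale/=; ring.
by move=> x /andP[x0 _]; rewrite mulr_ge0// sinh_ge0.
Qed.

(** For [x >= u] the derivative [u cosh x - sinh u] is at least [u cosh u - sinh u >= 0]. The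
    product form of the monotonicity of [sinh x / x] admits [u = 0]. *)
Lemma sinh_ratio_le u v : 0 <= u -> u <= v -> v * sinh u <= u * sinh v.
Proof.
move=> u0 uv; rewrite -subr_ge0.
have -> : 0 = u * sinh u - u * sinh u :> R by rewrite subrr.
apply: (ger0_is_derive_le (f := fun x => u * sinh x - x * sinh u)
  (df := fun x => u * cosh x - sinh u)) => //.
  move=> x; apply: is_derive_eq.
  by rewrite /GRing.scale/=; ring.
move=> x /andP[x0 _]; rewrite subr_ge0 (le_trans (sinh_le_mul_cosh u0))//.
rewrite ler_wpM2l//.
apply: (ger0_is_derive_le x0) => z /andP[z0 _].
by apply: sinh_ge0; exact: le_trans z0.
Qed.

(* The tangent inequality for [cosh] as a convex function of the square of its
   argument. *)
Lemma cosh_tangent u : 0 <= u ->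
  exists2 m, 0 <= m & forall v, cosh u + m * (v ^+ 2 - u ^+ 2) <= cosh v.
Proof.
rewrite le_eqVlt => /predU1P[<-|u0].
  (* The limit of [sinh u / (2 u)] as [u] tends to 0. *)
  exists 2^-1 => // v; rewrite -(cosh_norm v) -(real_normK (num_real v)).
  have := normr_ge0 v; move: `|v| => {}v v0.
  rewrite cosh0 -subr_ge0.
  have {1}-> : 0 = cosh 0 - 1 - 2^-1 * 0 ^+ 2 :> R by rewrite cosh0; ring.
  rewrite (_ : cosh v - _ = cosh v - 1 - 2^-1 * v ^+ 2); last by ring.
  apply: (ger0_is_derive_le (f := fun x => cosh x - 1 - 2^-1 * x ^+ 2)
    (df := fun x => sinh x - x)) => //.
    move=> x; apply: is_derive_eq.
    by rewrite /GRing.scale/=; field.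
  by move=> x /andP[x0 _]; rewrite subr_ge0 sinh_ge.
(* The derivative of [cosh (sqrt y)] at [y = u^2]. With this slope [phi] decreases on [[0, u]] and
   increases after [u], by [sinh_ratio_le]. *)
pose m := sinh u / (2 * u); exists m.
  by rewrite divr_ge0 ?sinh_ge0 ?mulr_ge0// ltW.
move=> v; rewrite -(cosh_norm v) -(real_normK (num_real v)).
have := normr_ge0 v; move: `|v| => {}v v0.
pose phi x := cosh x - m * x ^+ 2.
pose dphi x := sinh x - x * sinh u / u.
have dphiE (x : R) : is_derive x (1 : R) phi (dphi x).
  rewrite /phi; apply: is_derive_eq; rewrite /dphi /m /GRing.scale/=; field.
  by rewrite gt_eqF.
suff : phi u <= phi v by rewrite /phi; lra.
have [uv|/ltW vu] := leP u v.
  apply: (ger0_is_derive_le uv dphiE) => x /andP[ux _].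
  by rewrite subr_ge0 ler_pdivrMr// [leRHS]mulrC sinh_ratio_le// ltW.
rewrite -lerN2.
apply: (ger0_is_derive_le (f := \- phi) (df := \- dphi) vu) => x /andP[vx xu]/=.
rewrite oppr_ge0 subr_le0 ler_pdivlMr// [leLHS]mulrC sinh_ratio_le//.
exact: le_trans vx.
Qed.

(** The product [q x * expR (- x)] starts at 1 and is nondecreasing on [[0, 2]]; then
    [u^3 / 2 <= u^2] removes the cubic term. The range [[0, 2]] is that of the norms of the scaled
    increments below. *)
Lemma expR_le_sqr u : 0 <= u <= 2 -> expR u <= 1 + u + 3 / 2 * u ^+ 2.
Proof.
move=> /andP[u0 u2].
pose q x : R := 1 + x + x ^+ 2 / 2 + x ^+ 3 / 2.
have : q 0 * expR (- 0) <= q u * expR (- u).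
  apply: (ger0_is_derive_le (f := fun x => q x * expR (- x))
    (df := fun x => x ^+ 2 * (1 - x / 2) * expR (- x))) => //.
    move=> x; rewrite /q; apply: is_derive_eq.
    by rewrite /GRing.scale/=; field.
  by move=> x /andP[x0 xu]; rewrite mulr_ge0 ?expR_ge0// mulr_ge0 ?sqr_ge0//; lra.
rewrite oppr0 expR0 mulr1 expRN ler_pdivlMr ?expR_gt0//.
rewrite {1}/q !expr0n/= !mul0r !addr0 mul1r => /le_trans; apply.
rewrite /q; have : u ^+ 2 * (2 - u) >= 0 by rewrite mulr_ge0 ?sqr_ge0//; lra.
rewrite (exprS u 2); lra.
Qed.

End hyperbolic.

(** Young's inequality for the product [u * 1] with exponent [p] and its conjugate, multiplied by
    [p]. *)
Lemma Bernoulli_powR (R : realType) (p u : R) : 1 < p -> 0 <= u ->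
  1 + p * (u - 1) <= u `^ p.
Proof.
move=> p1 u0; have p0 : 0 < p by exact: lt_trans p1.
have q0 : 0 < 1 - p^-1 by rewrite subr_gt0 invf_lt1.
have := @conjugate_powR R u 1 p (1 - p^-1)^-1 u0 ler01 p0.
rewrite invr_gt0 => /(_ q0); rewrite invrK addrC subrK => /(_ erefl).
rewrite mulr1 powR1 mul1r -(ler_pM2r p0) mulrDl mulfVK ?gt_eqF//.
rewrite mulrBl mulVf ?gt_eqF//; lra.
Qed.

(** * Euclidean geometry *)

Definition dot (R : realType) (d : nat) (u v : 'rV[R]_d) : R :=
  \sum_(i < d) u 0 i * v 0 i.

Section euclidean.
Context (R : realType) (d : nat).
Implicit Types (u v s z : 'rV[R]_d) (a : R).

Lemma dotC u v : dot u v = dot v u.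
Proof. by apply: eq_bigr => i _; rewrite mulrC. Qed.

Lemma dotDl u v s : dot (u + v) s = dot u s + dot v s.
Proof. by rewrite -big_split; apply: eq_bigr => i _; rewrite mxE mulrDl. Qed.

Lemma dotZl a u v : dot (a *: u) v = a * dot u v.
Proof. by rewrite /dot mulr_sumr; apply: eq_bigr => i _; rewrite mxE mulrA. Qed.

Lemma dotNl u v : dot (- u) v = - dot u v.
Proof. by rewrite -scaleN1r dotZl mulN1r. Qed.

Lemma dotBl u v s : dot (u - v) s = dot u s - dot v s.
Proof. by rewrite dotDl dotNl. Qed.

Lemma dotDr u v s : dot s (u + v) = dot s u + dot s v.
Proof. by rewrite !(dotC s) dotDl. Qed.

Lemma dotZr a u v : dot u (a *: v) = a * dot u v.
Proof. by rewrite !(dotC u) dotZl. Qed.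

Lemma dotBr u v s : dot s (u - v) = dot s u - dot s v.
Proof. by rewrite !(dotC s) dotBl. Qed.

Lemma dot0l u : dot 0 u = 0.
Proof. by rewrite -(subrr u) dotBl subrr. Qed.

Lemma dot0r u : dot u 0 = 0.
Proof. by rewrite dotC dot0l. Qed.

Lemma dot_ge0 u : 0 <= dot u u.
Proof. by apply: sumr_ge0 => i _; rewrite -expr2 sqr_ge0. Qed.

Lemma sqr_enorm u : enorm u ^+ 2 = dot u u.
Proof.
rewrite sqr_sqrtr; last by apply: sumr_ge0 => i _; rewrite sqr_ge0.
by apply: eq_bigr => i _; rewrite expr2.
Qed.

Lemma enorm_ge0 u : 0 <= enorm u.
Proof. exact: sqrtr_ge0. Qed.

Lemma enorm0 : enorm (0 : 'rV[R]_d) = 0.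
Proof.
by apply/eqP; rewrite -sqrf_eq0 sqr_enorm /dot big1// => i _; rewrite mxE mul0r.
Qed.

Lemma enorm_eq0 u : (enorm u == 0) = (u == 0).
Proof.
apply/idP/eqP => [|->]; last by rewrite enorm0.
rewrite -sqrf_eq0 sqr_enorm psumr_eq0 => [|i _]; last by rewrite -expr2 sqr_ge0.
move=> /allP u0; apply/rowP => i; rewrite mxE.
by have := u0 i (mem_index_enum _); rewrite -expr2 sqrf_eq0 => /eqP.
Qed.

Lemma enormZ a u : enorm (a *: u) = `|a| * enorm u.
Proof.
apply: (@pexpIrn _ 2) => //; rewrite ?nnegrE ?mulr_ge0 ?enorm_ge0//.
by rewrite exprMn !sqr_enorm dotZl dotZr real_normK ?num_real// mulrA -expr2.
Qed.

Lemma ler_abs_enorm u i : `|u 0 i| <= enorm u.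
Proof.
rewrite -(@ler_pXn2r _ 2)// ?nnegrE ?enorm_ge0// sqr_enorm real_normK ?num_real//.
by rewrite /dot (bigD1 i)//= -expr2 lerDl sumr_ge0// => j _; rewrite -expr2 sqr_ge0.
Qed.

Lemma dot_le_enorm u v : dot u v <= enorm u * enorm v.
Proof.
have [/eqP|u0] := eqVneq (enorm u) 0.
  rewrite enorm_eq0 => /eqP ->; rewrite enorm0 mul0r.
  by rewrite dot0l.
have [/eqP|v0] := eqVneq (enorm v) 0.
  rewrite enorm_eq0 => /eqP ->; rewrite enorm0 mulr0.
  by rewrite dot0r.
(* Cauchy-Schwarz: this square equals [2 |u| |v| (|u| |v| - <u, v>)]. *)
have := dot_ge0 (enorm v *: u - enorm u *: v).
rewrite dotBl !dotBr !dotZl !dotZr -!sqr_enorm (dotC v u).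
have : 0 < enorm u * enorm v by rewrite mulr_gt0// lt_def ?u0 ?v0 enorm_ge0.
set x := enorm u; set y := enorm v => xy0 H.
rewrite -subr_ge0 -(pmulr_rge0 _ xy0); nra.
Qed.

Lemma dot_ge_enorm u v : - (enorm u * enorm v) <= dot u v.
Proof.
rewrite lerNl -dotNl (le_trans (dot_le_enorm _ _))//.
by rewrite -scaleN1r enormZ normrN1 mul1r.
Qed.

Lemma sqr_enormD u v :
  enorm (u + v) ^+ 2 = enorm u ^+ 2 + 2 * dot u v + enorm v ^+ 2.
Proof. by rewrite !sqr_enorm dotDl !dotDr (dotC v u); ring. Qed.

Lemma sqr_enormB u v :
  enorm (u - v) ^+ 2 = enorm u ^+ 2 - 2 * dot u v + enorm v ^+ 2.
Proof. by rewrite !sqr_enorm dotBl !dotBr (dotC v u); ring. Qed.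

Lemma enormN u : enorm (- u) = enorm u.
Proof. by rewrite -scaleN1r enormZ normrN1 mul1r. Qed.

Lemma ler_enormD u v : enorm (u + v) <= enorm u + enorm v.
Proof.
rewrite -(@ler_pXn2r _ 2)// ?nnegrE ?addr_ge0 ?enorm_ge0//.
by rewrite sqr_enormD; have := dot_le_enorm u v; nra.
Qed.

Lemma ler_enormB u v : enorm (u - v) <= enorm u + enorm v.
Proof. by rewrite (le_trans (ler_enormD _ _))// enormN. Qed.

Lemma ler_enorm_sum (I : Type) (r : seq I) (P : pred I) (f : I -> 'rV[R]_d) :
  enorm (\sum_(i <- r | P i) f i) <= \sum_(i <- r | P i) enorm (f i).
Proof.
elim/big_rec2: _ => [|i y x _ xy]; first by rewrite enorm0.
by rewrite (le_trans (ler_enormD _ _))// lerD2l.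
Qed.

Lemma enorm_le_sum u : enorm u <= \sum_(i < d) `|u 0 i|.
Proof.
rewrite {1}(row_sum_delta u) (le_trans (ler_enorm_sum _ _ _))// ler_sum// => i _.
rewrite enormZ -[leRHS]mulr1 ler_wpM2l//.
rewrite -(@ler_pXn2r _ 2)// ?nnegrE ?enorm_ge0// sqr_enorm /dot.
rewrite (bigD1 i)//= big1 => [|j ji]; rewrite !mxE ?eqxx/=.
  by rewrite mulr1 addr0 expr1n.
by rewrite (negbTE ji) mulr0.
Qed.

(* [cosh |s + z|] is convex as a function of the cosine of the angle between
   [s] and [z], hence bounded by the chord between [cosh (|s| - |z|)] and
   [cosh (|s| + |z|)]. *)
Lemma cosh_enormD_chord s z :
  cosh (enorm (s + z)) <= cosh (enorm s) * cosh (enorm z) +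
    sinh (enorm s) * sinh (enorm z) * (dot s z / (enorm s * enorm z)).
Proof.
have [/eqP|s0] := eqVneq (enorm s) 0.
  rewrite enorm_eq0 => /eqP ->.
  by rewrite add0r enorm0 sinh0 cosh0 !mul0r mul1r addr0.
have [/eqP|z0] := eqVneq (enorm z) 0.
  rewrite enorm_eq0 => /eqP ->.
  by rewrite addr0 enorm0 sinh0 cosh0 !(mul0r,mulr0) mulr1 addr0.
have [m m0 tangent] := cosh_tangent (enorm_ge0 (s + z)).
have := tangent (enorm s + enorm z); have := tangent (enorm s - enorm z).
rewrite coshB coshD sqr_enormD.
have AB0 : 0 < enorm s * enorm z by rewrite mulr_gt0// lt_def ?s0 ?z0 enorm_ge0.
set A := enorm s; set B := enorm z; pose tau := dot s z / (A * B).
rewrite -/tau.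
have -> : dot s z = tau * (A * B) by rewrite mulfVK// gt_eqF.
have tau1 : -1 <= tau <= 1.
  rewrite ler_pdivlMr// mulN1r dot_ge_enorm/= ler_pdivrMr// mul1r.
  exact: dot_le_enorm.
set C := cosh _ => H1 H2.
(* The weights of the chord. Since [(A + B)^2] and [(A - B)^2] differ from [|s + z|^2] by
   [2 A B (1 - tau)] and [- 2 A B (1 + tau)], these weights cancel the slope [m]. *)
have [h1 h2] : 0 <= (1 + tau) / 2 /\ 0 <= (1 - tau) / 2 by lra.
have := ler_wpM2l h1 H2; have := ler_wpM2l h2 H1; lra.
Qed.

(** With [A = |s|], [B = |z|], the chord's last term splits into a part linear in [z], which
    vanishes in mean for centred [z], and a multiple of [sinh A (sinh B - B)], bounded by
    [cosh A (sinh B - B)]. The remaining factor [e^B - B] has no first-order term in [B]. *)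
Lemma cosh_enormD s z :
  cosh (enorm (s + z)) <= cosh (enorm s) * (expR (enorm z) - enorm z) +
    sinh (enorm s) / enorm s * dot s z.
Proof.
apply: le_trans (cosh_enormD_chord s z) _.
have [/eqP|s0] := eqVneq (enorm s) 0.
  rewrite enorm_eq0 => /eqP ->.
  rewrite enorm0 sinh0 cosh0 !mul0r !mul1r -addr_cosh_sinh.
  by have := sinh_ge (enorm_ge0 z); lra.
have [/eqP|z0] := eqVneq (enorm z) 0.
  rewrite enorm_eq0 => /eqP ->.
  by rewrite enorm0 sinh0 cosh0 expR0 subr0 dot0r !(mul0r,mulr0).
have cs := dot_le_enorm s z.
have shz := sinh_ge (enorm_ge0 z).
have shs := sinh_ge0 (enorm_ge0 s).
have sc := sinh_le_cosh (enorm s).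
rewrite -addr_cosh_sinh.
have A0 : 0 < enorm s by rewrite lt_def s0 enorm_ge0.
have B0 : 0 < enorm z by rewrite lt_def z0 enorm_ge0.
set A := enorm s in s0 A0 cs shs sc *; set B := enorm z in z0 B0 cs shz *.
have -> : sinh A * sinh B * (dot s z / (A * B)) =
    sinh A / A * dot s z + (dot s z / (A * B)) * (sinh A * (sinh B - B)).
  by field; rewrite s0 z0.
have : dot s z / (A * B) <= 1 by rewrite ler_pdivrMr ?mul1r// mulr_gt0.
have : 0 <= sinh A * (sinh B - B) by rewrite mulr_ge0// subr_ge0.
move=> H1 H2; have := ler_wpM2r H1 H2.
have : sinh A * (sinh B - B) <= cosh A * (sinh B - B) by rewrite ler_wpM2r// subr_ge0.
lra.
Qed.

End euclidean.

(** * Descent along a smooth function *)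

Section descent.
Context (R : realType) (d : nat) (F : 'rV[R]_d -> R).
Hypothesis dF : forall x, differentiable F x.

Lemma derive_gradient x v : 'D_v F x = dot (gradient F x) v.
Proof.
rewrite deriveE; last exact: dF.
rewrite {1}(row_sum_delta v) linear_sum; apply: eq_bigr => i _.
by rewrite linearZ/= mxE -deriveE 1?mulrC//; exact: dF.
Qed.

Lemma is_derive_along_line x v (t : R) :
  is_derive t (1 : R) (fun t => F (x + t *: v)) (dot (gradient F (x + t *: v)) v).
Proof.
pose l (t : R) := x + t *: v.
have dl : is_diff t l (fun s => s *: v).
  by rewrite /l; apply: is_diff_eq; apply/funext => s /=; rewrite add0r.
have dFl : is_diff (l t) F ('d F (l t)) by apply: differentiableP; exact: dF.
have dc : is_diff t (F \o l) ('d F (l t) \o (fun s => s *: v)).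
  exact: is_diff_comp.
apply: DeriveDef.
  by apply/derivable1_diffP; exact: ex_diff.
rewrite -derive_gradient [LHS]deriveE; last exact: ex_diff.
by rewrite (diff_val (is_diff_def := dc))/= scale1r deriveE.
Qed.

(** The gap [h] between the quadratic model and [F] along the segment, up to a constant, has
    nonnegative derivative on [[0, 1]] by Cauchy-Schwarz and the Lipschitz bound. *)
Lemma descent (L : R) x v :
  (forall x y, enorm (gradient F x - gradient F y) <= L * enorm (x - y)) ->
  F (x + v) <= F x + dot (gradient F x) v + L / 2 * enorm v ^+ 2.
Proof.
move=> lip.
pose h (t : R) := t * dot (gradient F x) v + L / 2 * enorm v ^+ 2 * t ^+ 2
  - F (x + t *: v).
pose dh (t : R) := dot (gradient F x) v + L * enorm v ^+ 2 * t
  - dot (gradient F (x + t *: v)) v.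
have : h 0 <= h 1.
  refine (ger0_is_derive_le (f := h) (df := dh) ler01 _ _) => [t|t /andP[t0 t1]].
    rewrite /h; have := is_derive_along_line x v t => ?.
    by apply: is_derive_eq; rewrite /dh /GRing.scale/=; field.
  rewrite /dh -addrAC -dotBl.
  have := dot_ge_enorm (gradient F x - gradient F (x + t *: v)) v.
  have := lip x (x + t *: v).
  rewrite opprD addNKr enormN enormZ ger0_norm//.
  move=> H; have := ler_wpM2r (enorm_ge0 v) H; lra.
rewrite /h scale0r scale1r addr0; lra.
Qed.

(** Polarizing [<grad F, G>] in the descent inequality leaves [- (eta / 2) (1 - L eta) |G|^2], which
    is nonpositive and dropped; the differences of [F] telescope. The statement is deterministic and
    is applied path by path. *)
Lemma sgd_telescope (L : R) (Fstar : R) (T : nat) (eta : nat -> R)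
    (y G : nat -> 'rV[R]_d) : 0 < L ->
  (forall x y, enorm (gradient F x - gradient F y) <= L * enorm (x - y)) ->
  (forall x, Fstar <= F x) ->
  (forall t, (1 <= t <= T)%N -> 0 < eta t < 1 / L) ->
  (forall t, (1 <= t <= T)%N -> y t.+1 = y t - eta t *: G t) ->
  \sum_(1 <= t < T.+1) eta t * enorm (gradient F (y t)) ^+ 2 <=
  2 * (F (y 1%N) - Fstar) +
  \sum_(1 <= t < T.+1) eta t * enorm (G t - gradient F (y t)) ^+ 2.
Proof.
move=> L0 lip hF heta hy.
rewrite -lerBlDr -sumrB.
apply: (@le_trans _ _ (\sum_(1 <= t < T.+1) 2 * (F (y t) - F (y t.+1)))).
  rewrite !big_nat; apply: ler_sum => t; rewrite ltnS => tT.
  have /andP[e0 e1] := heta _ tT; rewrite hy//.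
  have := descent (y t) (- (eta t *: G t)) lip.
  rewrite -scaleNr dotZr enormZ normrN (gtr0_norm e0).
  rewrite sqr_enormB (dotC (G t)).
  have Le : L * eta t <= 1.
    by move: e1; rewrite ltr_pdivlMr// mulrC => /ltW.
  have : 0 <= eta t * enorm (G t) ^+ 2 * (1 - L * eta t).
    by rewrite mulr_ge0 ?subr_ge0// mulr_ge0 ?sqr_ge0// ltW.
  rewrite exprMn; lra.
rewrite -mulr_sumr ler_pM2l// -[leLHS]opprK -sumrN.
rewrite (eq_bigr (fun t => F (y t.+1) - F (y t))); last by move=> t _; rewrite opprB.
by rewrite telescope_sumr// opprB lerB.
Qed.

End descent.

(** * Borel measurability of random vectors *)

Section borel_rV.
Context (R : realType) (d : nat).

Lemma continuous_borel_rV (f : 'rV[R]_d -> R) :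
  continuous f -> measurable_fun setT (f : borel_rV R d -> R).
Proof.
move=> /continuousP cf; apply: (measurability _ (RGenOpens.measurableE R)).
move=> _ [_ [a [b ->] <-]]; rewrite setTI; apply: sub_sigma_algebra.
exact/cf/interval_open.
Qed.

Lemma measurable_coord (i : 'I_d) :
  measurable_fun setT (fun v : borel_rV R d => v 0 i).
Proof. by apply: continuous_borel_rV => v; exact: coord_continuous. Qed.

(** Rational corners make the family of boxes countable, so that open sets become countable unions
    of boxes. *)
Definition rat_box (a b : 'rV[rat]_d) : set 'rV[R]_d :=
  [set v | forall i, ratr (a 0 i) < v 0 i < ratr (b 0 i)].

Lemma open_bigcup_rat_box (A : set 'rV[R]_d) : open A ->
  A = \bigcup_(ab in [set ab | rat_box ab.1 ab.2 `<=` A]) rat_box ab.1 ab.2.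
Proof.
move=> oA; apply/seteqP; split; last by move=> v [ab /=]; exact.
move=> v Av.
have [P vP PA] : nbhs v A by exact: open_nbhs_nbhs.
have /choice[f fP] : forall i, exists q : rat * rat,
    ratr q.1 < v 0 i < ratr q.2 /\ forall r, ratr q.1 < r < ratr q.2 -> P 0 i r.
  move=> i; have /nbhs_ballP[e /= e0 eP] := vP 0 i.
  have /rat_in_itvoo[q1] : v 0 i - e < v 0 i by rewrite ltrBlDr ltrDl.
  have /rat_in_itvoo[q2] : v 0 i < v 0 i + e by rewrite ltrDl.
  rewrite !in_itv/= => /andP[h1 h2] /andP[h3 h4].
  exists (q1, q2) => /=; split; first by rewrite h1 h4.
  move=> r /andP[r1 r2]; apply: eP; rewrite /ball/= ltr_norml; lra.
exists (\row_i (f i).1, \row_i (f i).2) => /=.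
  move=> w /= wf; apply: PA => i j; rewrite (ord1 i).
  by apply: (fP j).2; have := wf j; rewrite !mxE.
by move=> i; rewrite !mxE; exact: (fP i).1.
Qed.

(** Preimages of open sets suffice, and these are countable unions of preimages of rational boxes,
    each a finite intersection of coordinate conditions. *)
Lemma measurable_fun_rV dT (T : measurableType dT) (f : T -> borel_rV R d) :
  (forall i, measurable_fun setT (fun t => f t 0 i)) -> measurable_fun setT f.
Proof.
move=> mf; apply: (@measurability _ _ _ (borel_rV R d) _ _
  (open : set (set 'rV[R]_d))) => //.
move=> _ [A oA <-]; rewrite setTI (open_bigcup_rat_box oA) preimage_bigcup.
rewrite bigcup_mkcond; apply: countable_bigcupT_measurable => // -[a b].
case: ifPn => // _; rewrite (_ : _ @^-1` _ =
    \bigcap_(i in [set: 'I_d]) [set t | ratr (a 0 i) < f t 0 i < ratr (b 0 i)]).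
  apply: fin_bigcap_measurable => // i _.
  rewrite -[X in measurable X]setTI
    (_ : [set t | _] = (fun t => f t 0 i) @^-1` `]ratr (a 0 i), ratr (b 0 i)[%classic).
    exact: mf.
  by apply/seteqP; split => t /=; rewrite in_itv.
by apply/seteqP; split => [t fab i _|t fab i]; exact: fab.
Qed.

Lemma measurable_fun_coord dT (T : measurableType dT) (f : T -> borel_rV R d) i :
  measurable_fun setT f -> measurable_fun setT (fun t => f t 0 i).
Proof. by move=> mf; exact: measurableT_comp (measurable_coord i) mf. Qed.

Context dT (T : measurableType dT).
Implicit Types (f h : T -> borel_rV R d) (a : T -> R).

Lemma measurable_rVD f h : measurable_fun setT f -> measurable_fun setT h ->
  measurable_fun setT (fun t => f t + h t : borel_rV R d).
Proof.
move=> mf mh; apply: measurable_fun_rV => i.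
rewrite (_ : (fun t => _) = (fun t => f t 0 i) \+ (fun t => h t 0 i)); last first.
  by apply/funext => t; rewrite mxE.
by apply: measurable_funD; exact: measurable_fun_coord.
Qed.

Lemma measurable_rVZ a f : measurable_fun setT a -> measurable_fun setT f ->
  measurable_fun setT (fun t => a t *: (f t : 'rV[R]_d) : borel_rV R d).
Proof.
move=> ma mf; apply: measurable_fun_rV => i.
rewrite (_ : (fun t => _) = a \* (fun t => f t 0 i)); last first.
  by apply/funext => t; rewrite mxE.
by apply: measurable_funM => //; exact: measurable_fun_coord.
Qed.

Lemma measurable_rVB f h : measurable_fun setT f -> measurable_fun setT h ->
  measurable_fun setT (fun t => f t - h t : borel_rV R d).
Proof.
move=> mf mh; apply: measurable_rVD => //.
rewrite (_ : (fun t => _) = (fun t => -1 *: (h t : 'rV[R]_d))).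
  by apply: measurable_rVZ.
by apply/funext => t; rewrite scaleN1r.
Qed.

Lemma measurable_rV_sum (I : eqType) (r : seq I) (h : I -> T -> borel_rV R d) :
  (forall i, i \in r -> measurable_fun setT (h i)) ->
  measurable_fun setT (fun t => \sum_(i <- r) h i t : borel_rV R d).
Proof.
elim: r => [_|i r ih mh].
  rewrite (_ : (fun t => _) = cst 0); first exact: measurable_cst.
  by apply/funext => t; rewrite big_nil.
rewrite (_ : (fun t => _) = (fun t => h i t + \sum_(i <- r) h i t)).
  apply: measurable_rVD; first by apply: mh; rewrite mem_head.
  by apply: ih => j jr; apply: mh; rewrite in_cons jr orbT.
by apply/funext => t; rewrite big_cons.
Qed.

Lemma measurable_dot f h : measurable_fun setT f -> measurable_fun setT h ->
  measurable_fun setT (fun t => dot (f t) (h t)).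
Proof.
move=> mf mh; rewrite (_ : (fun t => _) =
    (fun t => \sum_(i <- index_enum 'I_d)
      (fun i => (fun t => f t 0 i) \* (fun t => h t 0 i)) i t)).
  by apply: measurable_sum => i; apply: measurable_funM; exact: measurable_fun_coord.
by apply/funext => t.
Qed.

Lemma measurable_enorm f : measurable_fun setT f ->
  measurable_fun setT (fun t => enorm (f t)).
Proof.
move=> mf; rewrite (_ : (fun t => _) = (fun t => (fun x => x `^ 2^-1) (dot (f t) (f t)))).
  apply: (measurableT_comp (f := fun x : R => x `^ 2^-1)).
    exact: measurable_powR.
  exact: measurable_dot.
by apply/funext => t; rewrite powR12_sqrt ?dot_ge0.
Qed.

End borel_rV.

Lemma lipschitz_continuous_rV (R : realType) (d : nat) (L : R)
    (h : 'rV[R]_d -> 'rV[R]_d) : 0 <= L ->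
  (forall x y, enorm (h x - h y) <= L * enorm (x - y)) ->
  forall i, continuous (fun x => h x 0 i).
Proof.
move=> L0 lip i x A /nbhs_ballP[e /= e0 eA].
(* Balls here are those of the sup norm, and the Euclidean norm is at most [d] times it. The [+ 1]
   keeps the divisor positive and the final comparison strict. *)
have D0 : 0 < L * d%:R + 1 by rewrite ltr_wpDl// mulr_ge0.
apply/nbhs_ballP; exists (e / (L * d%:R + 1)); first exact: divr_gt0.
move=> y xy; apply: eA; rewrite /ball/=.
have -> : h x 0 i - h y 0 i = (h x - h y) 0 i by rewrite !mxE.
apply: le_lt_trans (ler_abs_enorm _ _) _; apply: le_lt_trans (lip _ _) _.
apply: (@le_lt_trans _ _ (L * (d%:R * (e / (L * d%:R + 1))))); last first.
  by rewrite 2!mulrA ltr_pdivrMr// [ltRHS]mulrC mulrA ltr_pM2r// ltrDl.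
rewrite ler_wpM2l//; apply: le_trans (enorm_le_sum _) _.
rewrite mulr_natl -[X in _ *+ X](card_ord d) -sumr_const.
by apply: ler_sum => j _; rewrite !mxE; have [_ xyj] := xy; exact: ltW (xyj 0 j).
Qed.

(** * Clipping *)

(** For [tau > 0], the radial projection onto the Euclidean ball of radius [tau]; the level [tau]
    stands for [alpha * k^(1 / beta)]. *)
Definition clip (R : realType) (d : nat) (tau : R) (v : 'rV[R]_d) : 'rV[R]_d :=
  (if v == 0 then 1 else Num.min 1 (tau / enorm v)) *: v.

Section clip.
Context (R : realType) (d : nat) (tau : R).
Hypothesis tau0 : 0 < tau.
Implicit Types v : 'rV[R]_d.

Lemma clipE v : exists2 c, 0 <= c <= 1 &
  clip tau v = c *: v /\ c * enorm v = Num.min (enorm v) tau.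
Proof.
rewrite /clip; case: eqVneq => [->|v0].
  exists 1; first by rewrite ler01 lexx.
  by rewrite enorm0 mulr0 min_l// ltW.
have e0 : 0 < enorm v by rewrite lt_def enorm_eq0 v0 enorm_ge0.
exists (Num.min 1 (tau / enorm v)).
  by rewrite le_min ler01 divr_ge0 ?enorm_ge0 ?(ltW tau0)//= ge_min lexx.
by split=> //; rewrite minr_pMl ?enorm_ge0// mul1r divfK// gt_eqF.
Qed.

Lemma enorm_clip v : enorm (clip tau v) = Num.min (enorm v) tau.
Proof. by have [c /andP[c0 _] [-> <-]] := clipE v; rewrite enormZ ger0_norm. Qed.

Lemma enorm_sub_clip v : enorm (v - clip tau v) = enorm v - Num.min (enorm v) tau.
Proof.
have [c /andP[c0 c1] [-> <-]] := clipE v.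
rewrite -[X in X - _ *: _]scale1r -scalerBl enormZ ger0_norm ?subr_ge0//.
by rewrite mulrBl mul1r.
Qed.

Lemma enorm_clip_le v : enorm (clip tau v) <= tau.
Proof. by rewrite enorm_clip ge_min lexx orbT. Qed.

Lemma enorm_sub_clip_le v : enorm (v - clip tau v) <= enorm v.
Proof. by rewrite enorm_sub_clip gerBl le_min enorm_ge0 ltW. Qed.

(** Bernoulli's inequality at [x / tau], multiplied by [tau / p]. It is used with a clipping level
    to bound the bias, and with [sigma] to bound means. *)
Lemma Young_powR (p x : R) : 1 < p -> 0 <= x ->
  x <= x `^ p * (tau `^ (1 - p) / p) + tau * ((p - 1) / p).
Proof.
move=> p1 x0; have p0 : 0 < p by exact: lt_trans p1.
have := Bernoulli_powR p1 (divr_ge0 x0 (ltW tau0)).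
rewrite powRM ?invr_ge0 ?(ltW tau0)//.
have -> : tau^-1 `^ p = tau `^ (- p).
  by rewrite -[in LHS](powR_inv1 (ltW tau0)) -powRrM mulN1r.
move=> H.
have -> : tau `^ (1 - p) = tau * tau `^ (- p).
  by rewrite powRD ?powRr1 ?(ltW tau0)// (gt_eqF tau0) implybT.
rewrite -(ler_pM2r p0) -(ler_pM2l (x := tau^-1)) ?invr_gt0//.
move: H; set q := _ `^ p; set r := _ `^ _.
have -> : tau^-1 * ((q * (tau * r / p) + tau * ((p - 1) / p)) * p) = q * r + (p - 1).
  by field; rewrite !gt_eqF.
by rewrite mulrA [tau^-1 * x]mulrC; lra.
Qed.

(** Above [tau] the left side is [|v| - tau], and [- tau] absorbs the constant of [Young_powR]. The
    factor [1 / p] is what lets the biases telescope in [bias_term_le]. *)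
Lemma enorm_sub_clip_le_powR (p : R) v : 1 < p ->
  enorm (v - clip tau v) <= enorm v `^ p * (tau `^ (1 - p) / p).
Proof.
move=> p1; have p0 : 0 < p by exact: lt_trans p1.
rewrite enorm_sub_clip minEle; case: ifPn => vt.
  by rewrite subrr mulr_ge0 ?powR_ge0// divr_ge0 ?powR_ge0 ?ltW.
have := Young_powR p1 (enorm_ge0 v).
have : tau * ((p - 1) / p) <= tau.
  by rewrite ger_pMr// ler_pdivrMr//; lra.
lra.
Qed.

Lemma sqr_enorm_clip_le (p : R) v : 0 < p <= 2 ->
  enorm (clip tau v) ^+ 2 <= enorm v `^ p * tau `^ (2 - p).
Proof.
move=> /andP[p0 p2]; set y := enorm (clip tau v).
have y0 : 0 <= y by exact: enorm_ge0.
have -> : y ^+ 2 = y `^ p * y `^ (2 - p).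
  by rewrite -powR_mulrn// -powRD addrC subrK// pnatr_eq0.
rewrite ler_pM ?powR_ge0//; apply: ge0_ler_powR => //;
  rewrite ?nnegrE ?enorm_ge0 ?subr_ge0 ?(ltW tau0) ?(ltW p0)//.
  by rewrite /y enorm_clip ge_min lexx.
exact: enorm_clip_le.
Qed.

End clip.

(** * Growth of [cosh] under one clipped increment *)

Section one_step.
Context (R : realType) (d : nat).
Implicit Types s mu v : 'rV[R]_d.

(** Replacing [clip tau v] by [v] in the cross term costs at most [2 |mu| |v|], bounded by Young at
    level [sigma]. The bound is affine in [v] and [|v|^p], so the known moments determine its mean
    or bound it. *)
Lemma sqr_enorm_clipB (tau p sigma : R) mu v : 0 < tau -> 0 < sigma -> 1 < p <= 2 ->
  enorm (clip tau v - mu) ^+ 2 <=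
  enorm v `^ p * tau `^ (2 - p) - 2 * dot v mu + enorm mu ^+ 2 +
  2 * enorm mu * (enorm v `^ p * (sigma `^ (1 - p) / p) + sigma * ((p - 1) / p)).
Proof.
move=> tau0 sigma0 /andP[p1 p2].
have p0 : 0 < p <= 2 by rewrite p2 (lt_trans _ p1).
rewrite sqr_enormB.
have H1 := sqr_enorm_clip_le tau0 v p0.
have H2 := dot_le_enorm (v - clip tau v) mu.
rewrite dotBl in H2.
have H3 := enorm_sub_clip_le tau0 v.
have H4 := Young_powR sigma0 p1 (enorm_ge0 v).
have H5 := ler_wpM2r (enorm_ge0 mu) (le_trans H3 H4).
nra.
Qed.

(** [cosh_enormD] for an increment of norm at most 2, as [tau] and [|mu|] are at most [b]; hence
    [expR_le_sqr] applies. The cross term becomes the centred [<s, v - mu>] plus the clipping bias,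
    whose coefficient [sinh |s|] is at most [cosh |s|]. *)
Lemma cosh_clip_step (tau b p sigma : R) s mu v :
  0 < tau <= b -> 0 < sigma <= b -> enorm mu <= sigma -> 1 < p <= 2 ->
  cosh (enorm (s + b^-1 *: (clip tau v - mu))) <=
  cosh (enorm s) * (1 + 3 / 2 * b^-1 ^+ 2 *
      (enorm v `^ p * tau `^ (2 - p) - 2 * dot v mu + enorm mu ^+ 2 +
       2 * enorm mu * (enorm v `^ p * (sigma `^ (1 - p) / p) + sigma * ((p - 1) / p)))
    + b^-1 * (enorm v `^ p * (tau `^ (1 - p) / p)))
  + sinh (enorm s) / enorm s * b^-1 * dot s (v - mu).
Proof.
move=> /andP[tau0 taub] /andP[sigma0 sigmab] mus /andP[p1 p2].
have b0 : 0 < b by exact: lt_le_trans taub.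
have l0 : 0 < b^-1 by rewrite invr_gt0.
have p12 : 1 < p <= 2 by rewrite p1.
have Z2 := sqr_enorm_clipB mu v tau0 sigma0 p12.
have Zb : b^-1 * enorm (clip tau v - mu) <= 2.
  rewrite mulrC ler_pdivrMr// (le_trans (ler_enormB _ _))//.
  by have := enorm_clip_le tau0 v; lra.
have B := enorm_sub_clip_le_powR tau0 v p1.
apply: le_trans (cosh_enormD _ _) _.
rewrite enormZ (gtr0_norm l0) dotZr.
set l := b^-1 in l0 Zb *.
set Z := enorm (clip tau v - mu) in Zb Z2 *.
set Q := _ + _ in Z2; rewrite -/Q.
have E : expR (l * Z) - l * Z <= 1 + 3 / 2 * l ^+ 2 * Q.
  have : 0 <= l * Z <= 2 by rewrite Zb mulr_ge0 ?enorm_ge0 ?ltW.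
  move=> /expR_le_sqr; rewrite exprMn.
  have := ler_wpM2l (sqr_ge0 l) Z2; lra.
have C0 := cosh_gt0 (enorm s).
have S0 := sinh_ge0 (enorm_ge0 s).
have SC := sinh_le_cosh (enorm s).
have -> : dot s (clip tau v - mu) = dot s (v - mu) - dot s (v - clip tau v).
  by rewrite !dotBr; ring.
have := dot_ge_enorm s (v - clip tau v).
set D := dot s (v - clip tau v); set W := enorm (v - clip tau v) in B *.
move=> DW.
have K : - (sinh (enorm s) / enorm s * (l * D)) <= cosh (enorm s) * (l * W).
  have [/eqP|s0] := eqVneq (enorm s) 0.
    rewrite enorm_eq0 => /eqP ->.
    by rewrite enorm0 sinh0 !mul0r oppr0 !mulr_ge0 ?enorm_ge0 ?ltW.
  apply: (@le_trans _ _ (sinh (enorm s) * (l * W))); last first.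
    by rewrite ler_wpM2r// mulr_ge0 ?enorm_ge0 ?ltW.
  have -> : sinh (enorm s) * (l * W) = sinh (enorm s) / enorm s * (l * (enorm s * W)).
    by field.
  have SA0 : 0 <= sinh (enorm s) / enorm s by rewrite divr_ge0 ?enorm_ge0.
  have := ler_wpM2l SA0 (ler_wpM2l (ltW l0) DW); lra.
have := ler_wpM2l (ltW C0) E.
have := ler_wpM2l (ltW C0) (ler_wpM2l (ltW l0) B).
lra.
Qed.

End one_step.

(** * Integration of bounds affine in a random vector and the [p]-th power of its norm *)

Section moments.
Context (R : realType) (d : nat) (dX : measure_display) (X : measurableType dX).
Context (D : probability X R) (V : X -> 'rV[R]_d) (mu : 'rV[R]_d) (p M : R).
Hypothesis mV : measurable_fun setT (V : X -> borel_rV R d).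
Hypothesis EV : forall i, ('E_D[(fun w => (V w 0 i)%R)] = (mu 0 i)%:E)%E.
Hypothesis EVp : ('E_D[(fun w => (enorm (V w) `^ p)%R)] <= M%:E)%E.
Hypothesis p1 : 1 < p.

Let Vp w := enorm (V w) `^ p.

Let mVp : measurable_fun setT Vp.
Proof.
apply: (measurableT_comp (f := fun x : R => x `^ p)); first exact: measurable_powR.
exact: measurable_enorm.
Qed.

Let iVp : D.-integrable setT (EFin \o Vp).
Proof.
apply/integrableP; split; first exact/measurable_EFinP.
move: EVp; rewrite unlock => /le_lt_trans; move/(_ +oo%E).
rewrite ltry => /(_ isT); congr (_ < _)%E; apply: eq_integral => w _ /=.
by rewrite ger0_norm// powR_ge0.
Qed.

Let iV i : D.-integrable setT (EFin \o (fun w => V w 0 i)).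
Proof.
have i1 : D.-integrable setT (EFin \o (fun w => 1 + Vp w)).
  rewrite (_ : EFin \o _ = fun w => 1%:E + (Vp w)%:E)%E; last exact/funext.
  apply: integrableD => //; exact: finite_measure_integrable_cst.
apply: (le_integrable _ _ _ i1) => //; first exact/measurable_EFinP/measurable_fun_coord.
(* Domination through [|v_i| <= |v| <= 1 + |v|^p], where [p > 1] is used. *)
move=> w _ /=; rewrite lee_fin [leRHS]ger0_norm ?addr_ge0 ?powR_ge0//.
apply: le_trans (ler_abs_enorm _ _) _; rewrite /Vp.
have [e1|/ltW e1] := leP (enorm (V w)) 1; first by rewrite ler_wpDr ?powR_ge0.
by apply: ler_wpDl => //; apply: le1r_powR => //; exact: ltW.
Qed.

(** The mean is known exactly, so [c1] is arbitrary; the [p]-th moment is only bounded above, hence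
    [0 <= c2]. Nonnegativity of [h] gives monotonicity of the integral without integrability of
    [h]. *)
Lemma integral_le_affine (h : X -> R) (c0 c2 : R) (c1 : 'rV[R]_d) :
  measurable_fun setT h -> 0 <= c2 ->
  (forall w, 0 <= h w <= c0 + dot c1 (V w) + c2 * enorm (V w) `^ p) ->
  (\int[D]_w (h w)%:E <= (c0 + dot c1 mu + c2 * M)%:E)%E.
Proof.
move=> mh c20 hle.
pose lin w := (\sum_(i <- index_enum 'I_d) (c1 0 i)%:E * (V w 0 i)%:E)%E.
have linE w : lin w = (dot c1 (V w))%:E.
  by rewrite /lin /dot -sumEFin; apply: eq_bigr => i _; rewrite EFinM.
have ilini i : D.-integrable setT (fun w => (c1 0 i)%:E * (V w 0 i)%:E)%E.
  exact: (integrableZl measurableT _ (iV i)).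
have ilin : D.-integrable setT lin by exact: integrable_sum.
have i0 : D.-integrable setT (EFin \o cst c0) by exact: finite_measure_integrable_cst.
have i2 : D.-integrable setT (fun w => c2%:E * (Vp w)%:E)%E.
  exact: (integrableZl measurableT _ iVp).
apply: (@le_trans _ _ (\int[D]_w (c0%:E + lin w + c2%:E * (Vp w)%:E))%E).
  apply: ge0_le_integral => //.
  - by move=> w _; rewrite lee_fin; have /andP[] := hle w.
  - exact/measurable_EFinP.
  - by apply: emeasurable_funD; [apply: emeasurable_funD|];
      [exact: measurable_int i0|exact: measurable_int ilin|
       exact: measurable_int i2].
  - by move=> w _; rewrite linE -EFinM -!EFinD lee_fin; have /andP[] := hle w.
rewrite integralD//; last exact: integrableD.
rewrite integralD//= integralZl// integral_cst//= probability_setT mule1.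
rewrite !EFinD EFinM; apply: leeD; last first.
  by apply: lee_wpmul2l; rewrite ?lee_fin//; move: EVp; rewrite unlock.
rewrite leeD2l//.
rewrite integral_sum// /dot -sumEFin; apply: lee_sum => i _.
rewrite integralZl//; last exact: iV.
by have := EV i; rewrite unlock => ->; rewrite EFinM.
Qed.

End moments.

Lemma measurable_cosh (R : realType) : measurable_fun setT (@cosh R).
Proof.
rewrite /cosh; apply: measurable_funM => //; apply: measurable_funD => //.
exact: (measurableT_comp (f := expR)).
Qed.

Lemma measurable_clip (R : realType) (d : nat) (tau : R)
    dT (T : measurableType dT) (f : T -> borel_rV R d) : measurable_fun setT f ->
  measurable_fun setT (fun t => clip tau (f t) : borel_rV R d).
Proof.
move=> mf; rewrite (_ : (fun t => _) = (fun t =>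
    Num.min 1 (tau * enorm (f t) `^ (- 1)) *: (f t : 'rV[R]_d))).
  apply: measurable_rVZ => //; apply: measurable_minr => //.
  apply: measurable_funM => //.
  apply: (measurableT_comp (f := fun x : R => x `^ (- 1))); first exact: measurable_powR.
  exact: measurable_enorm.
apply/funext => t; rewrite /clip powR_inv1 ?enorm_ge0//.
by case: eqVneq => // ->; rewrite !scaler0.
Qed.

(** * Clipping levels and the growth factor of one sample *)

Definition clip_level (R : realType) (p sigma c : R) (k : nat) : R :=
  sigma / c `^ p^-1 * k%:R `^ p^-1.

(** Closed form of the level at [k = n]; deviations are measured in this unit. *)
Definition clip_scale (R : realType) (p sigma c : R) (n : nat) : R :=
  sigma * (n%:R / c) `^ p^-1.

Section step_factor.
Context (R : realType) (p sigma c : R) (n : nat).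
Hypotheses (p12 : 1 < p <= 2) (sigma0 : 0 < sigma) (c0 : 0 < c) (cn : c <= n%:R).

Local Notation b := (clip_scale p sigma c n).
Local Notation tau := (clip_level p sigma c).

Let p1 : 1 < p. Proof. by have /andP[] := p12. Qed.
Let p2 : p <= 2. Proof. by have /andP[] := p12. Qed.
Let p0 : 0 < p. Proof. exact: lt_trans p1. Qed.
Let n0 : 0 < n%:R :> R. Proof. exact: lt_le_trans cn. Qed.
Let nc0 : 0 < n%:R / c. Proof. exact: divr_gt0. Qed.
Lemma clip_scale_gt0 : 0 < b. Proof. by rewrite mulr_gt0// powR_gt0. Qed.

Let b0 : 0 < b := clip_scale_gt0.

Lemma clip_scale_ge : sigma <= b.
Proof.
rewrite /clip_scale ler_peMr ?(ltW sigma0)//.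
have : 1 `^ p^-1 <= (n%:R / c) `^ p^-1; last by rewrite powR1.
rewrite ge0_ler_powR ?nnegrE ?invr_ge0 ?(ltW p0) ?(ltW nc0)//.
by rewrite ler_pdivlMr// mul1r.
Qed.

Lemma clip_levelE k : tau k = b * (k%:R / n%:R) `^ p^-1.
Proof.
rewrite /clip_level /clip_scale -[RHS]mulrA -powRM ?(ltW nc0) ?divr_ge0 ?(ltW n0)//.
rewrite (_ : _ / c * _ = c^-1 * k%:R); last by field; rewrite !gt_eqF.
have ic0 : 0 <= c^-1 by rewrite invr_ge0 ltW.
rewrite (powRM _ ic0 (ler0n _ k)) mulrA; congr (_ * _ * _).
by rewrite -[in RHS](powR_inv1 (ltW c0)) -powRrM mulN1r powRN.
Qed.

Lemma clip_level_gt0 k : 0 < tau k.+1.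
Proof. by rewrite clip_levelE mulr_gt0// powR_gt0// divr_gt0. Qed.

Lemma clip_level_le k : (k <= n)%N -> tau k <= b.
Proof.
move=> kn; rewrite clip_levelE ger_pMr//.
have : (k%:R / n%:R) `^ p^-1 <= 1 `^ p^-1; last by rewrite powR1.
rewrite ge0_ler_powR ?nnegrE ?invr_ge0 ?(ltW p0) ?divr_ge0 ?(ltW n0)//.
by rewrite ler_pdivrMr// mul1r ler_nat.
Qed.

Let sigma_pE : sigma `^ p = c / n%:R * b `^ p.
Proof.
rewrite /clip_scale powRM ?powR_ge0 ?(ltW sigma0)// -powRrM mulVf ?gt_eqF//.
by rewrite powRr1 ?(ltW nc0)//; field; rewrite !gt_eqF.
Qed.

(** By the choice of [b], [sigma^p = (c / n) b^p], and the level is at most [b]. *)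
Lemma variance_term_le k : (k < n)%N ->
  b^-1 ^+ 2 * (sigma `^ p * tau k.+1 `^ (2 - p)) <= c / n%:R.
Proof.
move=> kn; rewrite sigma_pE.
have -> : b^-1 ^+ 2 = (b `^ p)^-1 * (b `^ (2 - p))^-1.
  rewrite -invfM -powRD; last by rewrite (gt_eqF clip_scale_gt0) implybT.
  by rewrite addrC subrK powR_mulrn ?(ltW clip_scale_gt0)// exprVn.
have bp : 0 < b `^ p by rewrite powR_gt0.
have b2p : 0 < b `^ (2 - p) by rewrite powR_gt0.
have cancel x y z w : 0 < x -> 0 < y -> x^-1 * y^-1 * (w * x * z) = w * (z / y) :> R.
  by move=> x0 y0; field; rewrite !gt_eqF.
rewrite cancel//.
rewrite ger_pMr ?divr_gt0// ler_pdivrMr// mul1r.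
rewrite ge0_ler_powR ?subr_ge0 ?nnegrE ?(ltW clip_scale_gt0) ?(ltW (clip_level_gt0 _))//.
exact: clip_level_le.
Qed.

(** The left side is [(c / n)^(2 / p)], with [c / n <= 1] and exponent [2 / p >= 1]. *)
Lemma mean_term_le : b^-1 ^+ 2 * sigma ^+ 2 <= c / n%:R.
Proof.
rewrite -exprMn mulrC.
have -> : sigma / b = (c / n%:R) `^ p^-1.
  have -> : c / n%:R = (n%:R / c)^-1 by rewrite invf_div.
  rewrite -(powR_inv1 (ltW nc0)) -powRrM mulN1r powRN /clip_scale invfM mulrA divff ?mul1r//.
  by rewrite gt_eqF.
rewrite -powR_mulrn ?powR_ge0// -powRrM ge1r_powR//.
  by rewrite divr_gt0//= ler_pdivrMr// mul1r.
by rewrite mulrC ler_pdivlMr// mul1r.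
Qed.

(** With [x = (k + 1) / n] the left side is [c x^(1/p) / (p (k + 1))]. Bernoulli's inequality at
    [u = (1 - 1 / (k + 1))^(1/p)] expresses the concavity of [y^(1/p)] at [x]. Levels growing like
    [k^(1/p)] thus make the total bias telescope to [c]. *)
Lemma bias_term_le k : (k < n)%N ->
  b^-1 * (sigma `^ p * (tau k.+1 `^ (1 - p) / p)) <=
  c * ((k.+1%:R / n%:R) `^ p^-1 - (k%:R / n%:R) `^ p^-1).
Proof.
move=> kn; set x := k.+1%:R / n%:R : R.
have x0 : 0 < x by exact: divr_gt0.
have k0 : 0 < k.+1%:R :> R by [].
rewrite clip_levelE -/x sigma_pE powRM ?powR_ge0 ?(ltW clip_scale_gt0)//.
rewrite (powRB (x := b)); last by rewrite (gt_eqF clip_scale_gt0) implybT.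
rewrite powRr1 ?(ltW clip_scale_gt0)//.
have bp : 0 < b `^ p by rewrite powR_gt0.
have -> : (x `^ p^-1) `^ (1 - p) = x `^ p^-1 / x.
  rewrite -powRrM mulrBr mulr1 mulVf ?gt_eqF// powRB; last by rewrite (gt_eqF x0) implybT.
  by rewrite powRr1// ltW.
have y0 : 0 <= 1 - k.+1%:R^-1 :> R by rewrite subr_ge0 invf_le1// ler1n.
have -> : k%:R / n%:R = x * (1 - k.+1%:R^-1).
  by rewrite /x -natr1; field; rewrite natr1 !gt_eqF.
rewrite powRM ?(ltW x0)//.
set u := (1 - _) `^ _.
have : 1 + p * (u - 1) <= 1 - k.+1%:R^-1.
  have := Bernoulli_powR p1 (powR_ge0 (1 - k.+1%:R^-1) p^-1).
  by rewrite -powRrM mulVf ?gt_eqF// powRr1.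
move=> H.
have xp : 0 < x `^ p^-1 by rewrite powR_gt0.
rewrite (_ : b^-1 * _ = c * (x `^ p^-1 * (k.+1%:R^-1 / p))); last first.
  by rewrite {2}/x; field; rewrite !gt_eqF.
rewrite ler_pM2l// -[X in _ <= X - _]mulr1 -mulrBr ler_pM2l//.
rewrite ler_pdivrMr//; move: H; clearbody u; set z := _^-1; clearbody z; lra.
Qed.

(** The two second-moment terms contribute [3 / 2 * (c / n + c / n)]; then [1 + y <= e^y]. *)
Lemma step_factor_le k : (k < n)%N ->
  1 + 3 / 2 * b^-1 ^+ 2 * (sigma `^ p * tau k.+1 `^ (2 - p) + sigma ^+ 2) +
  b^-1 * (sigma `^ p * (tau k.+1 `^ (1 - p) / p)) <=
  expR (3 * c / n%:R + c * ((k.+1%:R / n%:R) `^ p^-1 - (k%:R / n%:R) `^ p^-1)).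
Proof.
move=> kn; apply: le_trans (expR_ge1Dx _).
have := variance_term_le kn; have := mean_term_le; have := bias_term_le kn; lra.
Qed.

End step_factor.

(** * Expected growth of [cosh] over one sample *)

Section expected_step.
Context (R : realType) (d : nat) (dX : measure_display) (X : measurableType dX).
Context (D : probability X R) (V : X -> 'rV[R]_d) (mu : 'rV[R]_d) (p sigma : R).
Hypothesis mV : measurable_fun setT (V : X -> borel_rV R d).
Hypothesis EV : forall i, ('E_D[(fun w => (V w 0 i)%R)] = (mu 0 i)%:E)%E.
Hypothesis EVp : ('E_D[(fun w => (enorm (V w) `^ p)%R)] <= (sigma `^ p)%:E)%E.
Hypotheses (p12 : 1 < p <= 2) (sigma0 : 0 < sigma).

Let p1 : 1 < p. Proof. by have /andP[] := p12. Qed.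
Let p0 : 0 < p. Proof. exact: lt_trans p1. Qed.

Lemma powR_cancel_mean : sigma `^ (1 - p) * sigma `^ p = sigma.
Proof.
by rewrite -powRD ?subrK ?powRr1 ?(ltW sigma0)// (gt_eqF sigma0) implybT.
Qed.

(** Integrating [0 <= |mu| * Y(|v|) - <mu, v>], with [Y] the bound of [Young_powR] at level [sigma],
    yields [0 <= |mu| (sigma - |mu|)]. The function integrated below is therefore 0. *)
Lemma enorm_mean_le : enorm mu <= sigma.
Proof.
have := @integral_le_affine _ _ _ _ _ _ _ _ _ mV EV EVp p1 (cst 0)
  (enorm mu * (sigma * ((p - 1) / p))) (enorm mu * (sigma `^ (1 - p) / p)) (- mu).
rewrite integral0_eq//.
move=> /(_ (measurable_cst _)); rewrite lee_fin.
have h0 : 0 <= enorm mu * (sigma `^ (1 - p) / p).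
  by rewrite mulr_ge0 ?enorm_ge0// divr_ge0 ?powR_ge0// ltW.
move=> /(_ h0); rewrite dotNl -sqr_enorm => H.
have : enorm mu * (sigma * ((p - 1) / p)) - enorm mu ^+ 2 +
    enorm mu * (sigma `^ (1 - p) / p) * sigma `^ p >= 0.
  apply: H => w; rewrite lexx/= dotNl.
  have := dot_le_enorm mu (V w).
  have := ler_wpM2l (enorm_ge0 mu) (Young_powR sigma0 p1 (enorm_ge0 (V w))).
  set a := _ `^ _; set q := _ `^ _; lra.
rewrite (_ : _ + _ = enorm mu * (sigma - enorm mu)).
  have [->|m0] := eqVneq (enorm mu) 0; first by move=> _; exact: ltW.
  by rewrite pmulr_rge0 ?subr_ge0// lt_def m0 enorm_ge0.
rewrite -mulrA (mulrAC _ p^-1) powR_cancel_mean; field.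
by rewrite gt_eqF.
Qed.

Lemma measurable_cosh_clip (tau b : R) (s : 'rV[R]_d) :
  measurable_fun setT (fun w => cosh (enorm (s + b^-1 *: (clip tau (V w) - mu)))).
Proof.
apply: (measurableT_comp (f := @cosh R));
  first exact: measurable_cosh.
apply: measurable_enorm; apply: measurable_rVD; first exact: measurable_cst.
apply: measurable_rVZ; first exact: measurable_cst.
apply: measurable_rVB; last exact: measurable_cst.
exact: measurable_clip.
Qed.

Lemma integral_cosh_clip (tau b : R) (s : 'rV[R]_d) :
  0 < tau <= b -> sigma <= b ->
  (\int[D]_w (cosh (enorm (s + b^-1 *: (clip tau (V w) - mu))))%:E <=
   (cosh (enorm s) *
     (1 + 3 / 2 * b^-1 ^+ 2 * (sigma `^ p * tau `^ (2 - p) + sigma ^+ 2) +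
      b^-1 * (sigma `^ p * (tau `^ (1 - p) / p))))%:E)%E.
Proof.
move=> taub sigmab; have /andP[tau0 _] := taub.
have b0 : 0 < b by exact: lt_le_trans sigmab.
have l0 : 0 < b^-1 by rewrite invr_gt0.
have mus := enorm_mean_le; have mu0 := enorm_ge0 mu.
have C0 := cosh_gt0 (enorm s).
pose S := sinh (enorm s) / enorm s * b^-1.
have sb : 0 < sigma <= b by rewrite sigma0.
pose A := cosh (enorm s) * (3 / 2 * b^-1 ^+ 2).
have A0 : 0 <= A.
  rewrite /A; apply: mulr_ge0; first exact: ltW.
  by apply: mulr_ge0; [lra|exact: sqr_ge0].
pose Y := sigma * ((p - 1) / p).
pose y := sigma `^ (1 - p) / p.
(* Constant, linear and [p]-th power coefficients of the bound in [cosh_clip_step]. The terms in [S]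
   cancel after integration. *)
pose c0 := cosh (enorm s) + A * (enorm mu ^+ 2 + 2 * enorm mu * Y) - S * dot s mu.
pose c1 := S *: s - (2 * A) *: mu.
pose c2 := A * (tau `^ (2 - p) + 2 * enorm mu * y) +
  cosh (enorm s) * (b^-1 * (tau `^ (1 - p) / p)).
have y0 : 0 <= y by rewrite /y divr_ge0 ?powR_ge0// ltW.
have c20 : 0 <= c2.
  rewrite /c2; apply: addr_ge0.
    apply: mulr_ge0 => //; apply: addr_ge0; first exact: powR_ge0.
    by apply: mulr_ge0 => //; exact: mulr_ge0.
  apply: mulr_ge0; first exact: ltW.
  by apply: mulr_ge0; rewrite ?divr_ge0 ?powR_ge0// ltW.
apply: le_trans (@integral_le_affine _ _ _ _ _ _ _ _ _ mV EV EVp p1 _ c0 c2 c1 _ c20 _) _.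
- exact: measurable_cosh_clip.
- move=> w; rewrite (ltW (cosh_gt0 _))/=.
  apply: le_trans (cosh_clip_step s (V w) taub sb mus p12) _.
  rewrite /c0 /c1 /c2 dotBl !dotZl dotBr (dotC (V w)) -/Y -/y -/S /A.
  by set a1 := tau `^ _; set a2 := tau `^ _; set q := enorm _ `^ _; lra.
- rewrite lee_fin /c0 /c1 /c2 dotBl !dotZl -sqr_enorm.
  have E : Y + y * sigma `^ p = sigma.
    by rewrite /Y /y mulrAC powR_cancel_mean; field; rewrite gt_eqF.
  (* Completing the square: [2 |mu| sigma - |mu|^2 <= sigma^2]. *)
  have : A * (- enorm mu ^+ 2 + 2 * enorm mu * (Y + y * sigma `^ p)) <= A * sigma ^+ 2.
    by rewrite E ler_wpM2l//; have := sqr_ge0 (sigma - enorm mu); lra.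
  rewrite /A; set a1 := tau `^ _; set a2 := tau `^ _; set q := sigma `^ p; lra.
Qed.

Lemma integral_cosh_clip_level (c : R) (n k : nat) (s : 'rV[R]_d) :
  0 < c -> c <= n%:R -> (k < n)%N ->
  (\int[D]_w (cosh (enorm (s + (clip_scale p sigma c n)^-1 *:
     (clip (clip_level p sigma c k.+1) (V w) - mu))))%:E <=
   (cosh (enorm s) * expR (3 * c / n%:R +
     c * ((k.+1%:R / n%:R) `^ p^-1 - (k%:R / n%:R) `^ p^-1)))%:E)%E.
Proof.
move=> c0 cn kn.
apply: le_trans (integral_cosh_clip s _ _) _.
- by rewrite (clip_level_gt0 _ sigma0 c0 cn) (clip_level_le p12 sigma0 c0 cn).
- exact: (clip_scale_ge p12 sigma0 c0 cn).
- by rewrite lee_fin ler_pM2l ?cosh_gt0// (step_factor_le p12 sigma0 c0 cn).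
Qed.

End expected_step.

(** * Independence of the past *)

Section independence.
Context (R : realType) (dO dX : measure_display).
Context (Omega : measurableType dO) (X : measurableType dX).
Context (P : probability Omega R) (I : finType) (Y : I -> {RV P >-> X}).

Definition cylinder (J : {set I}) : set (set Omega) :=
  [set E | exists2 A : I -> set X, (forall i, i \in J -> measurable (A i)) &
           E = \bigcap_(i in [set` J]) (Y i @^-1` A i)].

(** The sigma-algebra generated by the samples indexed by [J], on the carrier [Omega]: dependence on
    these samples alone becomes measurability on [past J]. *)
Definition past (J : {set I}) := g_sigma_algebraType (cylinder J).

Let mY i (B : set X) : measurable B -> measurable (Y i @^-1` B).
Proof. by move=> mB; rewrite -[X in measurable X]setTI; exact: measurable_funP. Qed.

Lemma cylinderT J : cylinder J setT.
Proof.
by exists (fun=> setT) => //; apply/seteqP; split.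
Qed.

Lemma cylinder_setI J : setI_closed (cylinder J).
Proof.
move=> _ _ [A mA ->] [B mB ->]; exists (fun i => A i `&` B i).
  by move=> i iJ; apply: measurableI; [exact: mA|exact: mB].
rewrite -bigcapI; apply: eq_bigcapr => i _; by rewrite preimage_setI.
Qed.

Lemma cylinder_measurable J : cylinder J `<=` measurable.
Proof.
move=> _ [A mA ->]; apply: fin_bigcap_measurable; first exact: finite_finset.
by move=> i /= iJ; apply: mY; exact: mA.
Qed.

Lemma past_measurable J (E : set Omega) :
  measurable (E : set (past J)) -> measurable E.
Proof.
apply: smallest_sub; last exact: cylinder_measurable.
exact: sigma_algebra_measurable.
Qed.

Lemma measurable_past_id J : measurable_fun setT (idfun : Omega -> past J).
Proof. by move=> _ E mE; rewrite setTI; exact: (past_measurable mE). Qed.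

Lemma measurable_past (J : {set I}) i : i \in J ->
  measurable_fun setT (Y i : past J -> X).
Proof.
move=> iJ _ B mB; rewrite setTI; apply: sub_sigma_algebra.
exists (fun j => if j == i then B else setT) => [j _|]; first by case: ifP.
apply/seteqP; split => [w /= YB j _|w /= /(_ i iJ)]; last by rewrite eqxx.
by case: eqP => [->|].
Qed.

Hypothesis indepY : mutually_independent Y.

(** Both sides are finite measures in [E]; they agree on the cylinders, a pi-system, by independence
    of the samples in [J] and [i]. *)
Lemma past_indep (J : {set I}) i (E : set Omega) (B : set X) : i \notin J ->
  measurable (E : set (past J)) -> measurable B ->
  (P (E `&` Y i @^-1` B) = P E * P (Y i @^-1` B))%E.
Proof.
move=> iJ mE mB; have mYB := mY i mB.
have PYB := fin_num_measure P _ mYB.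
have f0 : 0 <= fine (P (Y i @^-1` B)) by exact: fine_ge0.
transitivity (mscale (NngNum f0) P E); last by rewrite /mscale/= fineK// muleC.
apply: (g_sigma_algebra_measure_unique (cylinder J) _ (fun=> setT) _ _ (mrestr P mYB)) => //.
- exact: cylinder_measurable.
- by move=> _; exact: cylinderT.
- by rewrite bigcup_const.
- exact: cylinder_setI.
- move=> _ [A mA ->]; set C := \bigcap_(j in _) _.
  change (P (C `&` Y i @^-1` B) = (fine (P (Y i @^-1` B)))%:E * P C)%E.
  rewrite fineK// {}/C.
  (* As [i] is not in [J], the set [A i] may be replaced by [B]: one family then describes both
     events. *)
  have -> : \bigcap_(j in [set` J]) Y j @^-1` A j =
      \bigcap_(j in [set` J]) Y j @^-1` (if j == i then B else A j).
    apply: eq_bigcapr => j /= jJ; case: eqP => // ji.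
    by rewrite ji (negbTE iJ) in jJ.
  have -> : \bigcap_(j in [set` J]) Y j @^-1` (if j == i then B else A j) `&` Y i @^-1` B
     = \bigcap_(j in [set` i |: J]) Y j @^-1` (if j == i then B else A j).
    apply/seteqP; split => [w [wJ wB] j /=|w wJ].
      by rewrite !inE => /orP[/eqP ->|jJ]; [rewrite eqxx|exact: wJ].
    split => [j /= jJ|]; first by apply: wJ; rewrite /= !inE jJ orbT.
    by have := wJ i; rewrite /= !inE eqxx; exact.
  have mA' j : j \in i |: J -> measurable (if j == i then B else A j).
    by rewrite !inE; case: eqP => //= _; exact: mA.
  rewrite (indepY mA') indepY; last by move=> j jJ; apply: mA'; rewrite !inE jJ orbT.
  by rewrite big_setU1//= eqxx.
- move=> _; change (P (setT `&` Y i @^-1` B) < +oo)%E.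
  by rewrite setTI (le_lt_trans (probability_le1 P mYB))// ltry.
Qed.

Context (D : probability X R) (J : {set I}) (i : I).
Hypothesis YD : forall A, measurable A -> distribution P (Y i) A = D A.
Hypothesis iJ : i \notin J.

(* Conditionally on the past, the new sample has distribution [D]. *)
Lemma integral_le_freeze (phi : past J * X -> \bar R) (psi : Omega -> \bar R) :
  measurable_fun setT phi -> (forall z, 0 <= phi z)%E ->
  measurable_fun setT psi ->
  (forall w : Omega, \int[D]_x phi (w, x) <= psi w)%E ->
  (\int[P]_w phi (w, Y i w) <= \int[P]_w psi w)%E.
Proof.
move=> mphi phi0 mpsi phipsi.
(* The identity as a random variable with values in [past J]; its law is [P] restricted to the
   past. *)
pose idP : {mfun Omega >-> past J} := HB.pack (idfun : Omega -> past J)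
  (isMeasurableFun.Build _ _ _ _ _ (@measurable_past_id J)).
have mjoint : measurable_fun setT (fun w : Omega => (w, Y i w) : past J * X).
  by apply: measurable_fun_pair; [exact: measurable_past_id|exact: measurable_funP].
pose joint : {mfun Omega >-> (past J * X)%type} := HB.pack
  (fun w : Omega => (w, Y i w) : past J * X)
  (isMeasurableFun.Build _ _ _ _ _ mjoint).
have -> : (\int[P]_w phi (w, Y i w) = \int[distribution P joint]_z phi z)%E.
  by rewrite ge0_integral_distribution.
(* The joint law of past and new sample is the product law, since they agree on rectangles; Tonelli
   then integrates the new sample first. *)
have -> : (\int[distribution P joint]_z phi z =
    \int[distribution P idP \x D]_z phi z)%E.
  apply: eq_measure_integral => A mA _; apply/esym.
  apply: product_measure_unique => // E B mE mB.
  change (P (E `&` Y i @^-1` B) = P E * D B)%E.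
  by rewrite -YD//; exact: (past_indep iJ mE mB).
rewrite fubini_tonelli1//.
rewrite ge0_integral_distribution//; first last.
  by move=> w; apply: integral_ge0.
  exact: measurable_fun_fubini_tonelli_F.
apply: ge0_le_integral => //.
- by move=> w _; apply: integral_ge0.
- apply: (measurableT_comp (f := fubini_F D phi)); last exact: measurable_past_id.
  exact: measurable_fun_fubini_tonelli_F.
- by move=> w _; exact: phipsi.
Qed.

End independence.

(** * Deviations of PS-Clip-SGD *)

Lemma measurable_gradient (R : realType) (d : nat) (L : R) (F : 'rV[R]_d -> R) :
  0 <= L ->
  (forall x y, enorm (gradient F x - gradient F y) <= L * enorm (x - y)) ->
  measurable_fun setT (gradient F : borel_rV R d -> borel_rV R d).
Proof.
move=> L0 lip; apply: measurable_fun_rV => i; apply: continuous_borel_rV.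
exact: lipschitz_continuous_rV lip i.
Qed.

Section ps_clip.
Context (R : realType) (d : nat) (F : 'rV[R]_d -> R).
Context (dO dX : measure_display).
Context (Omega : measurableType dO) (X : measurableType dX).
Context (P : probability Omega R) (D : probability X R).
Context (p sigma c : R) (T n : nat).
Context (g : 'rV[R]_d -> X -> 'rV[R]_d) (eta : nat -> R) (x1 : 'rV[R]_d).
Context (xi : nat -> nat -> {RV P >-> X}) (x : nat -> Omega -> 'rV[R]_d).
Hypothesis mF : measurable_fun setT (gradient F : borel_rV R d -> borel_rV R d).
Hypothesis hg : stochastic_gradient_oracle D p sigma F g.
Hypothesis hxi : iid_samples D T n xi.
Hypothesis hx :
  ps_clip_sgd g (sigma / c `^ p^-1) p T n eta x1 (fun t k w => xi t k w) x.

Definition clipped_deviation (t j : nat) (w : Omega) : 'rV[R]_d :=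
  clip (clip_level p sigma c j) (g (x t w) (xi t j w)) - gradient F (x t w).

Definition deviation_sum (t k : nat) (w : Omega) : 'rV[R]_d :=
  \sum_(1 <= j < k.+1) clipped_deviation t j w.

Lemma deviation_sumS t k w :
  deviation_sum t k.+1 w = deviation_sum t k w + clipped_deviation t k.+1 w.
Proof. by rewrite /deviation_sum big_nat_recr. Qed.

Lemma ps_clip_gradientE y (z : nat -> X) :
  ps_clip_gradient g (sigma / c `^ p^-1) p n y z =
  (1 / n%:R) *: \sum_(1 <= k < n.+1) clip (clip_level p sigma c k) (g y (z k)).
Proof.
rewrite /ps_clip_gradient; congr (_ *: _); apply: eq_bigr => k _.
by rewrite /clip_factor /clip /clip_level div1r.
Qed.

Let mg : measurable_fun setT
  (fun z : borel_rV R d * X => g z.1 z.2 : borel_rV R d).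
Proof. by case: hg. Qed.

Section measurability.
Context (d' : measure_display) (O' : measurableType d') (u : O' -> Omega).

Let measurable_oracle (t k : nat) :
  measurable_fun setT (x t \o u : O' -> borel_rV R d) ->
  measurable_fun setT (xi t k \o u : O' -> X) ->
  measurable_fun setT (fun w => g (x t (u w)) (xi t k (u w)) : borel_rV R d).
Proof.
move=> mx mxi; have mxxi := measurable_fun_pair mx mxi.
exact: (measurableT_comp mg mxxi).
Qed.

(** [x t.+1] involves only the samples of iterations up to [t]. The map [u] is the identity for
    measurability on [Omega], and the projection from [past J * X] for measurability with respect to
    the past. *)
Lemma measurable_iterate (t : nat) : (t <= T)%N ->
  (forall t' k, (1 <= t' <= t)%N -> (1 <= k <= n)%N ->
     measurable_fun setT (xi t' k \o u : O' -> X)) ->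
  measurable_fun setT (x t.+1 \o u : O' -> borel_rV R d).
Proof.
case: hx => hx1 hx2; elim: t => [_ _|t ih tT mxi].
  rewrite (_ : _ \o _ = cst x1); first exact: measurable_cst.
  by apply/funext => w /=; rewrite hx1.
have mxt : measurable_fun setT (x t.+1 \o u : O' -> borel_rV R d).
  apply: ih => [|t' k /andP[t'0 t't] kn]; first exact: ltnW.
  by apply: mxi => //; rewrite t'0 ltnW.
rewrite (_ : _ \o _ = fun w => x t.+1 (u w) - eta t.+1 *: ((1 / n%:R) *:
    \sum_(1 <= k < n.+1)
      clip (clip_level p sigma c k) (g (x t.+1 (u w)) (xi t.+1 k (u w))))).
  apply: measurable_rVB; first exact: mxt.
  apply: measurable_rVZ; first exact: measurable_cst.
  apply: measurable_rVZ; first exact: measurable_cst.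
  apply: measurable_rV_sum => k; rewrite mem_index_iota ltnS => kn.
  by apply: measurable_clip; apply: measurable_oracle => //; apply: mxi; rewrite //= leqnn.
apply/funext => w; transitivity (x t.+2 (u w)); first by [].
by rewrite (hx2 t.+1 (u w) tT) ps_clip_gradientE.
Qed.

Lemma measurable_deviation_sum (t k : nat) : (1 <= t <= T)%N -> (k <= n)%N ->
  measurable_fun setT (x t \o u : O' -> borel_rV R d) ->
  (forall j, (1 <= j <= k)%N -> measurable_fun setT (xi t j \o u : O' -> X)) ->
  measurable_fun setT (deviation_sum t k \o u : O' -> borel_rV R d).
Proof.
move=> tT kn mx mxi; apply: measurable_rV_sum => j.
rewrite mem_index_iota ltnS => jk; apply: measurable_rVB.
  by apply: measurable_clip; apply: measurable_oracle => //; exact: mxi.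
exact: (measurableT_comp mF mx).
Qed.

End measurability.

Lemma measurable_iterateT t : (1 <= t <= T.+1)%N ->
  measurable_fun setT (x t : Omega -> borel_rV R d).
Proof.
case: t => // t /=; rewrite ltnS => tT.
by apply: (measurable_iterate (u := idfun)) => // t' k _ _; exact: measurable_funP.
Qed.

Hypotheses (p12 : 1 < p <= 2) (sigma0 : 0 < sigma) (c0 : 0 < c) (cn : c <= n%:R).

Local Notation b := (clip_scale p sigma c n).

Lemma measurable_cosh_deviation t k : (1 <= t <= T)%N -> (k <= n)%N ->
  measurable_fun setT (fun w => cosh (enorm (b^-1 *: deviation_sum t k w))).
Proof.
move=> tT kn; apply: (measurableT_comp (f := @cosh R));
  first exact: measurable_cosh.
apply: measurable_enorm; apply: measurable_rVZ; first exact: measurable_cst.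
apply: (measurable_deviation_sum (u := idfun)) => //.
by apply: measurable_iterateT; case/andP: tT => -> /=; exact: leqW.
Qed.

(** Induction on the samples of iteration [t], multiplying the growth factors; at [k = n] the
    exponent is [3 c + c]. *)
Lemma integral_cosh_deviation t k : (1 <= t <= T)%N -> (k <= n)%N ->
  (\int[P]_w (cosh (enorm (b^-1 *: deviation_sum t k w)))%:E <=
   (expR (3 * c / n%:R * k%:R + c * (k%:R / n%:R) `^ p^-1))%:E)%E.
Proof.
move=> tT; have /andP[t0 tleT] := tT.
elim: k => [_|k ih kn].
  under eq_integral do rewrite /deviation_sum big_geq// scaler0 enorm0 cosh0.
  rewrite integral_cst//= probability_setT mule1 lee_fin.
  by rewrite -expR0 ler_expR mulr0 add0r mulr_ge0 ?powR_ge0// ltW.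
have tT' : (t.-1 < T)%N by rewrite prednK.
pose i : 'I_T * 'I_n := (Ordinal tT', Ordinal kn).
(* All samples of the iterations before [t] and the first [k] of iteration [t]; ordinals start at 0,
   so [i] is sample [k + 1]. *)
pose J : {set 'I_T * 'I_n} :=
  [set j : 'I_T * 'I_n | (j.1 < t.-1)%N || (j.1 == t.-1 :> nat) && (j.2 < k)%N]%SET.
pose Y (j : 'I_T * 'I_n) := xi j.1.+1 j.2.+1.
have iJ : i \notin J by rewrite inE /= !ltnn andbF.
have it : i.1.+1 = t by rewrite /= prednK.
have YD A : measurable A -> distribution P (Y i) A = D A.
  by move=> mA; apply: (hxi.1 _ _ _ _ A mA); rewrite ?it//=.
pose e := expR (3 * c / n%:R + c * ((k.+1%:R / n%:R) `^ p^-1 - (k%:R / n%:R) `^ p^-1)).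
pose phi (z : past Y J * X) : \bar R := (cosh (enorm (b^-1 *: deviation_sum t k z.1 +
  b^-1 *: (clip (clip_level p sigma c k.+1) (g (x t z.1) z.2) - gradient F (x t z.1)))))%:E.
pose psi w : \bar R := (cosh (enorm (b^-1 *: deviation_sum t k w)) * e)%:E.
have mpast t' k' : (1 <= t' <= T)%N -> (1 <= k' <= n)%N ->
    (t' < t)%N || (t' == t) && (k' <= k)%N ->
    measurable_fun setT ((xi t' k' : Omega -> X) \o (fst : past Y J * X -> Omega)).
  move=> /andP[t'0 t'T] /andP[k'0 k'n] H.
  have t'p : (t'.-1 < T)%N by rewrite prednK.
  have k'p : (k'.-1 < n)%N by rewrite prednK.
  have jJ : (Ordinal t'p, Ordinal k'p) \in J.
    rewrite inE /=; move: H.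
    by case: t' t'0 {t'T t'p} => // t' _; case: k' k'0 {k'n k'p} => // k' _; case: (t) t0.
  have -> : xi t' k' = Y (Ordinal t'p, Ordinal k'p) by rewrite /Y/= !prednK.
  exact: (measurableT_comp (measurable_past (Y := Y) jJ) measurable_fst).
have mxt : measurable_fun setT
    ((x t : Omega -> borel_rV R d) \o (fst : past Y J * X -> Omega)).
  rewrite -it; apply: measurable_iterate; first by rewrite /= ltnW.
  move=> t' k' /andP[t'0 t't] k'n; apply: mpast => //.
    by rewrite t'0/= (leq_trans t't)//= ltnW.
  by rewrite -[X in (_ < X)%N]it ltnS t't.
have mphi : measurable_fun setT phi.
  apply/measurable_EFinP; apply: (measurableT_comp (f := @cosh R));
    first exact: measurable_cosh.
  apply: measurable_enorm; apply: measurable_rVD.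
    apply: measurable_rVZ; first exact: measurable_cst.
    apply: (@measurable_deviation_sum _ _ (fst : past Y J * X -> Omega)) => //.
      exact: ltnW.
    move=> j /andP[j0 jk]; apply: mpast => //; last by rewrite eqxx jk orbT.
    by rewrite j0 (leq_trans jk)// ltnW.
  apply: measurable_rVZ; first exact: measurable_cst.
  apply: measurable_rVB; last exact: (measurableT_comp mF mxt).
  apply: measurable_clip.
  exact: (measurableT_comp mg (measurable_fun_pair mxt measurable_snd)).
have mpsi : measurable_fun setT psi.
  apply/measurable_EFinP; apply: measurable_funM => //.
  by apply: measurable_cosh_deviation => //; exact: ltnW.
have step : (\int[P]_w phi (w, Y i w) <= \int[P]_w psi w)%E.
  apply: (integral_le_freeze hxi.2 YD iJ mphi _ mpsi).
    by move=> z; rewrite lee_fin ltW// cosh_gt0.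
  (* With [w] frozen, [x t w] and the partial sum are constants, and the oracle assumptions hold at
     the point [x t w]. *)
  move=> w; rewrite /phi /psi /=; case: hg => _ EV EVp.
  apply: (@integral_cosh_clip_level _ _ _ _ D (g (x t w)) (gradient F (x t w))) => //.
  exact: (measurableT_comp mg (pair1_measurable (x t w : borel_rV R d))).
have YE : Y i = xi t k.+1 by rewrite /Y /= prednK.
apply: (@le_trans _ _ (\int[P]_w phi (w, Y i w))%E).
  rewrite le_eqVlt; apply/orP; left; apply/eqP; apply: eq_integral => w _.
  by rewrite deviation_sumS scalerDr YE.
apply: (le_trans step).
rewrite /psi; under eq_integral do rewrite EFinM.
rewrite ge0_integralZr//; last 3 first.
- by apply/measurable_EFinP; apply: measurable_cosh_deviation => //; exact: ltnW.
- by move=> w _; rewrite lee_fin ltW// cosh_gt0.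
- by rewrite lee_fin expR_ge0.
apply: (@le_trans _ _ ((expR (3 * c / n%:R * k%:R + c * (k%:R / n%:R) `^ p^-1))%:E * e%:E)%E).
  apply: lee_wpmul2r; first by rewrite lee_fin expR_ge0.
  exact/ih/ltnW.
rewrite -EFinM lee_fin -expRD ler_expR -natr1; set a := _ `^ _; set a' := _ `^ _.
lra.
Qed.

End ps_clip.

(** * From the bound on the mean of [cosh] to a tail bound *)

Lemma markov_ge0 (R : realType) (dO : measure_display) (Omega : measurableType dO)
    (P : probability Omega R) (h : Omega -> R) (a : R) : 0 < a ->
  measurable_fun setT h -> (forall w, 0 <= h w) ->
  (a%:E * P [set w | (a <= h w)%R] <= \int[P]_w (h w)%:E)%E.
Proof.
move=> a0 mh h0.
have mid : measurable_fun setT (id : \bar R -> \bar R) by exact: measurable_id.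
have hE : measurable_fun setT (EFin \o h) by exact/measurable_EFinP.
have id0 (r : \bar R) : (0 <= r -> 0 <= r)%E by [].
have := le_integral_comp_abse P measurableT mid id0 (fun _ _ _ _ H => H) hE a0.
rewrite setTI.
have -> : [set w | (a%:E <= `|(EFin \o h) w|)%E] = [set w | a <= h w].
  by apply/seteqP; split => w /=; rewrite lee_fin ger0_norm.
by under eq_integral do rewrite /= ger0_norm//.
Qed.

(** Averaging the tangent at [u] bounds the mean of [cosh] below by [cosh u + m (S - u^2)], [S]
    being the mean square. The strict hypothesis gives [m (S - u^2) < 0], so [m >= 0] suffices. *)
Lemma sum_le_of_cosh_mean_lt (R : realType) (I : finType) (a N : I -> R) (u : R) :
  0 <= u -> (forall i, 0 <= a i) -> \sum_i a i = 1 ->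
  \sum_i a i * cosh (N i) < cosh u -> \sum_i a i * N i ^+ 2 <= u ^+ 2.
Proof.
move=> u0 a0 a1 lt_cosh; have [m m0 tangent] := cosh_tangent u0.
have : \sum_i a i * (cosh u + m * (N i ^+ 2 - u ^+ 2)) < cosh u.
  apply: le_lt_trans lt_cosh; apply: ler_sum => i _.
  by rewrite ler_wpM2l.
rewrite (eq_bigr (fun i => a i * (cosh u - m * u ^+ 2) + m * (a i * N i ^+ 2))); last first.
  by move=> i _; ring.
rewrite big_split/= -mulr_suml a1 -mulr_sumr mul1r; nra.
Qed.

Section ps_clip_tail.
Context (R : realType) (d : nat) (F : 'rV[R]_d -> R).
Context (dO dX : measure_display).
Context (Omega : measurableType dO) (X : measurableType dX).
Context (P : probability Omega R) (D : probability X R).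
Context (p sigma c : R) (T n : nat).
Context (g : 'rV[R]_d -> X -> 'rV[R]_d) (eta : nat -> R) (x1 : 'rV[R]_d).
Context (xi : nat -> nat -> {RV P >-> X}) (x : nat -> Omega -> 'rV[R]_d).
Hypothesis mF : measurable_fun setT (gradient F : borel_rV R d -> borel_rV R d).
Hypothesis hg : stochastic_gradient_oracle D p sigma F g.
Hypothesis hxi : iid_samples D T n xi.
Hypothesis hx :
  ps_clip_sgd g (sigma / c `^ p^-1) p T n eta x1 (fun t k w => xi t k w) x.
Hypotheses (p12 : 1 < p <= 2) (sigma0 : 0 < sigma) (c0 : 0 < c).

Local Notation b := (clip_scale p sigma c n).
Local Notation G t w :=
  (ps_clip_gradient g (sigma / c `^ p^-1) p n (x t w) (fun k => xi t k w)).
Local Notation S := (deviation_sum F p sigma c g xi x).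

Let p0 : 0 < p. Proof. by have /andP[p1 _] := p12; exact: lt_trans p1. Qed.

Lemma deviation_sumE t w : (0 < n)%N ->
  S t n w = n%:R *: (G t w - gradient F (x t w)).
Proof.
move=> n0; rewrite /deviation_sum ps_clip_gradientE scalerBr scalerA.
rewrite mulrA mulr1 divff ?scale1r; last by rewrite pnatr_eq0 -lt0n.
by rewrite sumrB sumr_const_nat subn1 scaler_nat.
Qed.

Lemma measurable_cosh_mean_tail (a : 'I_T -> R) (u : R) :
  measurable [set w | u <= \sum_(t < T) a t * cosh (enorm (b^-1 *: S t.+1 n w))].
Proof.
rewrite -[X in measurable X]setTI.
apply: (@measurable_fun_ler _ _ _ _ (cst u)) => //.
apply: (@measurable_sum _ _ _ _ _ (index_enum 'I_T)
  (fun (t : 'I_T) w => a t * cosh (enorm (b^-1 *: S t.+1 n w)))) => t.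
apply: measurable_funM => //.
by apply: (measurable_cosh_deviation mF hg hx); rewrite /= ?ltn_ord.
Qed.

Section tail_bound.
Hypothesis cn : c <= n%:R.

Let n0 : 0 < n%:R :> R. Proof. exact: lt_le_trans cn. Qed.

(** Because [b (c / n) = sigma (c / n)^(1 - 1/p)]. An argument [7 c] of [cosh] thus corresponds to a
    squared error [49 sigma^2 (c / n)^(2 (p - 1) / p)]. *)
Lemma sqr_cosh_argE t w : enorm (b^-1 *: S t n w) ^+ 2 =
  c ^+ 2 * (enorm (G t w - gradient F (x t w)) ^+ 2 /
            (sigma ^+ 2 * (c / n%:R) `^ (2 * (p - 1) / p))).
Proof.
have nN : (0 < n)%N by rewrite -(ltr0n R).
rewrite deviation_sumE// scalerA enormZ exprMn real_normK ?num_real//.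
suff -> : (b^-1 * n%:R) ^+ 2 = c ^+ 2 / (sigma ^+ 2 * (c / n%:R) `^ (2 * (p - 1) / p)).
  by rewrite mulrAC -mulrA.
have b0 : 0 < b by apply: clip_scale_gt0 cn.
have cn0 : 0 < c / n%:R by exact: divr_gt0.
have -> : sigma ^+ 2 * (c / n%:R) `^ (2 * (p - 1) / p) = (b * (c / n%:R)) ^+ 2.
  have -> : b = sigma * (c / n%:R) `^ (- p^-1).
    rewrite /clip_scale; congr (_ * _).
    by rewrite powRN -(invf_div c) -(powR_inv1 (ltW cn0)) -powRrM mulN1r powRN.
  have -> : sigma * (c / n%:R) `^ (- p^-1) * (c / n%:R) =
      sigma * (c / n%:R) `^ (- p^-1 + 1).
    by rewrite powRD ?powRr1 ?(ltW cn0) ?mulrA// (gt_eqF cn0) implybT.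
  rewrite exprMn; congr (_ * _).
  rewrite -powR_mulrn ?powR_ge0// -powRrM; congr (_ `^ _).
  by field; rewrite gt_eqF.
by field; rewrite !gt_eqF.
Qed.

(** The bound [e^(4c)] holds for each iteration, hence for any convex combination with deterministic
    weights; Markov and [cosh (7c) >= e^(7c) / 2] conclude. *)
Lemma cosh_mean_tail (a : 'I_T -> R) :
  (forall t, 0 <= a t) -> \sum_t a t = 1 ->
  (P [set w | (cosh (7 * c) <= \sum_(t < T) a t * cosh (enorm (b^-1 *: S t.+1 n w)))%R] <=
   (2 * expR (- (3 * c)))%:E)%E.
Proof.
move=> a0 a1.
pose Z w := \sum_(t < T) a t * cosh (enorm (b^-1 *: S t.+1 n w)).
have mN (t : 'I_T) : measurable_fun setT (fun w => cosh (enorm (b^-1 *: S t.+1 n w))).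
  by apply: (measurable_cosh_deviation mF hg hx); rewrite /= ?ltn_ord.
have Z0 w : 0 <= Z w by apply: sumr_ge0 => t _; rewrite mulr_ge0// ltW// cosh_gt0.
have mZ : measurable_fun setT Z.
  apply: (@measurable_sum _ _ _ _ _ (index_enum 'I_T)
    (fun (t : 'I_T) w => a t * cosh (enorm (b^-1 *: S t.+1 n w)))) => t.
  by apply: measurable_funM => //.
have EZ : (\int[P]_w (Z w)%:E <= (expR (4 * c))%:E)%E.
  under eq_integral do rewrite /Z -sumEFin.
  rewrite ge0_integral_sum//; last 2 first.
  - by move=> t; apply/measurable_EFinP; exact: measurable_funM.
  - by move=> t w _; rewrite lee_fin mulr_ge0// ltW// cosh_gt0.
  have -> : ((expR (4 * c))%:E = \sum_(t < T) (a t)%:E * (expR (4 * c))%:E)%E.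
    rewrite -ge0_sume_distrl; last by move=> t _; rewrite lee_fin.
    by rewrite sumEFin a1 mul1e.
  apply: lee_sum => t _; under eq_integral do rewrite EFinM.
  rewrite ge0_integralZl//; last 3 first.
  - exact/measurable_EFinP.
  - by move=> w _; rewrite lee_fin ltW// cosh_gt0.
  - by rewrite lee_fin.
  apply: lee_wpmul2l; first by rewrite lee_fin.
  have := integral_cosh_deviation mF hg hxi hx p12 sigma0 c0 cn (t := t.+1)
    (ltn_ord t) (leqnn n).
  move=> /le_trans; apply; rewrite lee_fin ler_expR divff ?gt_eqF// powR1 divfK ?gt_eqF//=.
  lra.
have C0 := cosh_gt0 (7 * c).
have := le_trans (markov_ge0 P C0 mZ Z0) EZ.
have mE := measurable_cosh_mean_tail a (cosh (7 * c)).
rewrite -(fineK (fin_num_measure P _ mE)) -EFinM !lee_fin => H.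
rewrite -(ler_pM2l C0) (le_trans H)//.
apply: (@le_trans _ _ (expR (7 * c) / 2 * (2 * expR (- (3 * c))))).
  by rewrite mulrA divfK// -expRD ler_expR; lra.
by rewrite ler_wpM2r ?cosh_ge_expR// mulr_ge0 ?expR_ge0.
Qed.

End tail_bound.

(* A batch too small for clipping to bite: all clipping levels are below [sigma]. *)
Lemma enorm_error_small_batch t w : (0 < n)%N -> n%:R <= c ->
  enorm (G t w - gradient F (x t w)) <= 2 * sigma.
Proof.
move=> n0 nc; have nR : 0 < n%:R :> R by rewrite ltr0n.
rewrite (le_trans (ler_enormB _ _))// mulr2n mulrDl mul1r lerD//.
  rewrite ps_clip_gradientE enormZ ger0_norm; last by rewrite divr_ge0.
  rewrite mulrAC mul1r ler_pdivrMr//.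
  apply: (le_trans (ler_enorm_sum _ _ _)).
  have -> : sigma * n%:R = \sum_(1 <= k < n.+1) sigma.
    by rewrite sumr_const_nat subn1 mulr_natr.
  rewrite !big_nat; apply: ler_sum => k; rewrite ltnS => /andP[k0 kn].
  have kR : 0 < k%:R :> R by rewrite ltr0n.
  have tau0 : 0 < clip_level p sigma c k.
    by rewrite mulr_gt0 ?divr_gt0 ?powR_gt0.
  apply: (le_trans (enorm_clip_le tau0 _)).
  rewrite /clip_level -mulrA ger_pMr// mulrC ler_pdivrMr ?powR_gt0// mul1r.
  rewrite ge0_ler_powR ?nnegrE ?invr_ge0 ?(ltW p0) ?(ltW c0)//.
  by rewrite (le_trans _ nc)// ler_nat.
case: hg => mg EV EVp.
have mgx : measurable_fun setT (g (x t w) : X -> borel_rV R d).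
  exact: (measurableT_comp mg (pair1_measurable (x t w : borel_rV R d))).
exact: (enorm_mean_le mgx (EV (x t w)) (EVp (x t w)) p12 sigma0).
Qed.

End ps_clip_tail.

(** * Choice of the level and the convergence bound *)

Lemma two_expR_le (R : realType) (c : R) : 1 / 4 <= c ->
  2 * expR (- (3 * c)) <= expR (1 / 4 - c).
Proof.
move=> c4; have -> : 1 / 4 - c = 1 / 4 + 2 * c + - (3 * c) by ring.
rewrite expRD ler_pM2r ?expR_gt0//.
(* As [c >= 1/4], the exponent [1/4 + 2 c] is at least [3/4 = 6/8], and [(1 + 1/8)^6 >= 2]. *)
have /le_trans -> // : (2 : R) <= expR (6%:R * 8^-1).
  rewrite expRM_natl.
  apply: (@le_trans _ _ ((1 + 8^-1) ^+ 6)).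
    by rewrite !exprS expr0; lra.
  by rewrite ler_pXn2r ?nnegrE ?expR_ge0 ?expR_ge1Dx//; lra.
by rewrite ler_expR; lra.
Qed.

Theorem theorem3p3 (R : realType) (d : nat) (hd : (1 <= d)%N)
    (L : R) (hL : 0 < L) (F : 'rV[R]_d -> R) (hF : smooth L F)
    (Fstar : R) (hFstar : forall x, Fstar <= F x)
    (dX : measure_display) (X : measurableType dX) (D : probability X R)
    (p sigma : R) (hp : 1 < p <= 2) (hsigma : 0 < sigma)
    (g : 'rV[R]_d -> X -> 'rV[R]_d)
    (hg : stochastic_gradient_oracle D p sigma F g)
    (T n : nat) (hT : (1 <= T)%N) (hn : (1 <= n)%N)
    (x1 : 'rV[R]_d) (delta : R) (hdelta : 0 < delta < 1)
    (eta : nat -> R)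
    (heta : forall t, (1 <= t <= T)%N -> 0 < eta t < 1 / L)
    (dO : measure_display) (Omega : measurableType dO) (P : probability Omega R)
    (xi : nat -> nat -> {RV P >-> X}) (hxi : iid_samples D T n xi)
    (alpha beta : R)
    (halpha : alpha = sigma / (ln (1 / delta) + 1 / 4) `^ (1 / p))
    (hbeta : beta = p)
    (x : nat -> Omega -> 'rV[R]_d)
    (hx : ps_clip_sgd g alpha beta T n eta x1 (fun t k w => xi t k w) x) :
  ((1 - delta)%:E <=
   P [set w |
      (\sum_(1 <= t < T.+1)
         eta t * enorm (gradient F (x t w)) ^+ 2 /
         (\sum_(1 <= s < T.+1) eta s)
      <= 2 * (F x1 - Fstar) / (\sum_(1 <= t < T.+1) eta t)
         + 49 * sigma ^+ 2 *
           ((ln (1 / delta) + ln T%:R + 1 / 4) / n%:R)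
             `^ (2 * (p - 1) / p))%R])%E.
Proof.
have /andP[p1 p2] := hp; have p0 : 0 < p by exact: lt_trans p1.
have /andP[delta0 delta1] := hdelta.
pose c := ln (1 / delta) + 1 / 4.
have lnd : ln (1 / delta) = - ln delta by rewrite div1r lnV.
have c4 : 1 / 4 <= c by rewrite /c lerDr lnd oppr_ge0 ln_le0// ltW.
have c0 : 0 < c by lra.
have nR : 0 < n%:R :> R by rewrite ltr0n.
have hx' : ps_clip_sgd g (sigma / c `^ p^-1) p T n eta x1 (fun t k w => xi t k w) x.
  by move: hx; rewrite halpha hbeta -/c div1r.
case: (hx') => hx1 hx2; case: hF => dF lip.
have mF := measurable_gradient (ltW hL) lip.
pose q := 2 * (p - 1) / p.
have q0 : 0 <= q by rewrite divr_ge0 ?(ltW p0)// mulr_ge0// subr_ge0 ltW.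
set W := \sum_(1 <= s < T.+1) eta s.
have W0 : 0 < W.
  rewrite /W big_nat_recl// ltr_wpDr ?(andP (heta _ _)).1//.
  rewrite big_nat; apply: sumr_ge0 => t /andP[t1 tT].
  by apply/ltW; have /andP[] : 0 < eta t.+1 < 1 / L by exact: heta.
set l := _ + _ + _.
(* The bound is established with [c]; since [ln T >= 0], it implies the one with [l]. *)
have cl : c <= l by rewrite /c /l addrAC lerDl ln_ge0// ler1n.
set E := [set w | _].
pose a (t : 'I_T) := eta t.+1 / W.
have a0 t : 0 <= a t.
  by rewrite divr_ge0 ?(ltW W0)//; apply/ltW; have /andP[] := heta t.+1 (ltn_ord t).
have a1 : \sum_t a t = 1.
  have WE : W = \sum_(t < T) eta t.+1 by rewrite /W big_add1 big_mkord.
  by rewrite -mulr_suml -WE divff// gt_eqF.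
pose err t w := enorm (ps_clip_gradient g (sigma / c `^ p^-1) p n (x t w)
  (fun k => xi t k w) - gradient F (x t w)) ^+ 2.
have mE : measurable E.
  pose f w := \sum_(t < T) eta t.+1 * enorm (gradient F (x t.+1 w)) ^+ 2 / W.
  have mf : measurable_fun setT f.
    apply: (@measurable_sum _ _ _ _ _ (index_enum 'I_T)
      (fun (t : 'I_T) w => eta t.+1 * enorm (gradient F (x t.+1 w)) ^+ 2 / W)) => t.
    apply: measurable_funM => //; apply: measurable_funM => //.
    apply: measurable_funX; apply: measurable_enorm; apply: (measurableT_comp mF).
    by apply: (measurable_iterateT hg hx'); exact: leqW (ltn_ord t).
  rewrite -[X in measurable X]setTI.
  rewrite (_ : E = [set w | f w <= 2 * (F x1 - Fstar) / W +
      49 * sigma ^+ 2 * (l / n%:R) `^ q]).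
    exact: (measurable_fun_ler mf (measurable_cst _)).
  by apply/seteqP; split => w; rewrite /E /f /= big_add1 big_mkord.
(* By the telescoped descent inequality, a bound on the weighted mean squared error at [w] places
   [w] in [E]. *)
have goodE w : \sum_t a t * err t.+1 w <= 49 * (sigma ^+ 2 * (c / n%:R) `^ q) -> E w.
  move=> good; rewrite /E/=.
  have := @sgd_telescope _ _ F dF L Fstar T eta (x ^~ w) (fun t => ps_clip_gradient g
    (sigma / c `^ p^-1) p n (x t w) (fun k => xi t k w)) hL lip hFstar heta
    (fun t tT => hx2 t w tT).
  rewrite hx1 -mulr_suml ler_pdivrMr// (mulrDl (_ / W)) divfK ?gt_eqF// => /le_trans; apply.
  rewrite lerD2l big_add1 big_mkord.
  have -> : \sum_(i < T) eta i.+1 * enorm (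
      ps_clip_gradient g (sigma / c `^ p^-1) p n (x i.+1 w)
      (fun k => xi i.+1 k w) - gradient F (x i.+1 w)) ^+ 2 =
      (\sum_t a t * err t.+1 w) * W.
    rewrite mulr_suml; apply: eq_bigr => t _; rewrite /a mulrAC divfK//.
    by rewrite gt_eqF.
  rewrite ler_pM2r// (le_trans good)// mulrA ler_pM2l; last first.
    by rewrite mulr_gt0// exprn_gt0.
  have l0 : 0 <= l by exact: le_trans (ltW c0) cl.
  rewrite -/q (ge0_ler_powR q0) ?nnegrE ?divr_ge0 ?(ltW c0) ?(ltW nR)//.
  by rewrite ler_pM2r// invr_gt0.
(* If [n <= c], the error is at most [2 sigma] surely and [4 sigma^2 <= 49 sigma^2 (c / n)^q], so
   [E] is the whole space. *)
have [nc|/ltW cn] := leP n%:R c.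
  have -> : E = setT.
    apply/seteqP; split => // w _; apply: goodE.
    apply: (@le_trans _ _ (\sum_t a t * (2 * sigma) ^+ 2)).
      have s0 : 0 <= 2 * sigma by rewrite mulr_ge0// ltW.
      apply: ler_sum => t _; rewrite ler_wpM2l// ler_pXn2r ?nnegrE ?enorm_ge0//.
      exact: (enorm_error_small_batch xi x hg hp hsigma c0).
    rewrite -mulr_suml a1 mul1r exprMn.
    have : 1 <= (c / n%:R) `^ q.
      rewrite -[X in X <= _](powRr0 (c / n%:R)); apply: ler_powR => //.
      by rewrite ler_pdivlMr// mul1r.
    have : 0 < sigma ^+ 2 by rewrite exprn_gt0.
    set s := sigma ^+ 2; set z := _ `^ _; nra.
  by rewrite probability_setT lee_fin lerBlDr lerDl ltW.
pose N (t : 'I_T) w := enorm (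
  (clip_scale p sigma c n)^-1 *: deviation_sum F p sigma c g xi x t.+1 n w).
pose B := [set w | cosh (7 * c) <= \sum_(t < T) a t * cosh (N t w)].
(* Outside [B], Jensen bounds the weighted mean of [N^2] by [(7 c)^2]; rescaling by [sqr_cosh_argE]
   gives the hypothesis of [goodE]. *)
have BE : ~` E `<=` B.
  move=> w nE; rewrite /B/= leNgt; apply/negP => lt_cosh; apply: nE; apply: goodE.
  have c7 : 0 <= 7 * c by rewrite mulr_ge0// ltW.
  have := sum_le_of_cosh_mean_lt c7 a0 a1 lt_cosh.
  have c20 : 0 < c ^+ 2 by rewrite exprn_gt0.
  have K0 : 0 < sigma ^+ 2 * (c / n%:R) `^ q.
    by rewrite mulr_gt0 ?exprn_gt0// powR_gt0// divr_gt0.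
  rewrite (eq_bigr (fun t => c ^+ 2 / (sigma ^+ 2 * (c / n%:R) `^ q) * (a t * err t.+1 w))).
    rewrite -mulr_sumr exprMn -ler_pdivlMl ?divr_gt0// => /le_trans; apply.
    have cancel (u v : R) : 0 < u -> 0 < v -> (u / v)^-1 * (7 ^+ 2 * u) = 49 * v.
      by move=> u0 v0; field; rewrite !gt_eqF.
    by rewrite cancel.
  move=> t _; rewrite /N (sqr_cosh_argE F g xi x hp hsigma c0 cn) -/q /err.
  have comm (u v y z : R) : u * (v * (y * z)) = v * z * (u * y) by ring.
  exact: comm.
have mB : measurable B by exact: (measurable_cosh_mean_tail mF hg hx' a).
have PB : (P (~` E) <= delta%:E)%E.
  apply: (@le_trans _ _ (P B)).
    by apply: le_measure; rewrite ?inE//; exact: measurableC.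
  apply: (le_trans (cosh_mean_tail mF hg hxi hx' hp hsigma c0 cn a0 a1)).
  (* By the choice of [c], [e^(1/4 - c) = delta]. *)
  rewrite lee_fin (le_trans (two_expR_le c4))//.
  by rewrite (_ : 1 / 4 - c = ln delta) ?lnK ?posrE// /c lnd; lra.
rewrite -[E]setCK probability_setC; last exact: measurableC.
by rewrite EFinB leeB.
Qed.
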